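(* Let $G$ be a moderately computable graph. If $G$ satisfies $\mathcal{E}_1$, then $G$ admits a computable one-way infinite Eulerian path. If $G$ satisfies $\mathcal{E}_2$, then $G$ admits a computable two-way infinite Eulerian path.
   Context: Graphs are undirected, finite or infinite; loops and multiple edges are allowed. Each edge joins a pair of (possibly equal) vertices and is incident to them. The degree $\deg_G(v)\in\mathbb{N}\cup\{\infty\}$ is the number of edges incident to $v$, loops counted twice; ''even degree'' or ''odd degree'' means finite and even, resp. finite and odd. A graph is finite if its edge set is finite, and infinite otherwise. $0\in\mathbb{N}$. A graph homomorphism sends vertices to vertices and edges to edges, compatibly with incidence. $\llbracket a,b\rrbracket$ (integers $a\le b$) is the graph with vertex set $\{a,\dots,b\}$ and an edge $\{c,c+1\}$ joining $c$ to $c+1$ for each $a\le c<b$; $\llbracket\mathbb{N}\rrbracket$ and $\llbracket\mathbb{Z}\rrbracket$ are defined similarly. A path (resp. one-way infinite path, two-way infinite path) on $G$ is a graph homomorphism from some $\llbracket a,b\rrbracket$ (resp. from $\llbracket\mathbb{N}\rrbracket$, from $\llbracket\mathbb{Z}\rrbracket$) to $G$ that does not repeat edges (vertices may repeat). It is Eulerian if it visits every edge of $G$ exactly once. $G$ is connected if every pair of vertices is joined by a path. For a set of edges $E\subset E(G)$, $G[E]$ is the subgraph with edge set $E$ and vertex set the vertices incident to some edge in $E$; $G-E$ is $G[E(G)\setminus E]$ (remove the edges in $E$, then all vertices left without incident edges). A connected component is a maximal connected subgraph. The number of ends of $G$ is the supremum, over finite sets $E$ of edges, of the number of infinite connected components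 of $G-E$. $G$ satisfies $\mathcal{E}_1$ if: $E(G)$ is countable and infinite; $G$ is connected; either $G$ has exactly one vertex with odd degree, or $G$ has at least one vertex with infinite degree and no vertices with odd degree; $G$ has one end. $G$ satisfies $\mathcal{E}_2$ if: $E(G)$ is countable and infinite; $G$ is connected; the degree of each vertex is infinite or even; $G$ has one or two ends, and moreover, whenever $E$ is a finite set of edges such that all vertices of $G[E]$ have even degree in $G[E]$, the graph $G-E$ has one infinite connected component. A graph is computable when its vertex and edge sets are indexed by decidable sets of natural numbers in such a manner that the adjacency relation $\{(u,v)\in V(G)^2\mid u,v\text{ adjacent}\}$ and the incidence relation $\{(e,u,v)\in E(G)\times V(G)^2\mid e\text{ joins }u\text{ to }v\}$ are decidable. A moderately computable graph is a computable graph for which the vertex degree function $\deg_G\colon V(G)\to\mathbb{N}\cup\{\infty\}$ is computable. An infinite path is computable if the functions sending $n$ to (the indices of) its $n$-th vertex and to the image of the edge $\{n,n+1\}$ are computable. *)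

(* Defs.v *)
From mathcomp Require Import all_boot all_order all_algebra.
From mathcomp Require Import boolp classical_sets functions cardinality.

Set Implicit Arguments.
Unset Strict Implicit.
Unset Printing Implicit Defensive.

Import Order.TTheory GRing.Theory Num.Theory.

Local Open Scope classical_set_scope.
Local Open Scope nat_scope.

(** * Extended natural numbers: [None] stands for infinity *)

Definition enat := option nat.

Definition enat_le (x y : enat) : Prop :=
  match x, y with
  | _, None => True
  | None, Some _ => False
  | Some m, Some n => m <= n
  end.

Definition enat_add (x y : enat) : enat :=
  match x, y with
  | Some m, Some n => Some (m + n)
  | _, _ => None
  end.

Definition enat_code (x : enat) : nat := if x is Some n then n.+1 else 0.

(* [finite_set A] unfolds to [exists n, A #= `I_n], and such an [n] is
   unique. *)
Definition ecard (T : Type) (A : set T) : enat :=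
  match pselect (finite_set A) with
  | left fin => Some (projT1 (cid fin))
  | right _ => None
  end.

(** * Graphs *)

(* A graph consists of subsets of two carrier types, so that its subgraphs
   live on the same carriers.  [joins e u v] states that the edge [e] joins
   [u] to [v]; the last field says that the pair of endpoints of an edge is
   unique up to the order of its two elements. *)
Record graph (V E : Type) := Graph {
  verts : set V;
  edges : set E;
  joins : E -> V -> V -> Prop;
  joins_in : forall e u v, joins e u v -> [/\ edges e, verts u & verts v];
  joins_ex : forall e, edges e -> exists u v, joins e u v;
  joins_sym : forall e u v, joins e u v -> joins e v u;
  joins_uniq : forall e u v u' v', joins e u v -> joins e u' v' ->
    (u' = u /\ v' = v) \/ (u' = v /\ v' = u)
}.

Definition adjacent (V E : Type) (G : graph V E) (u v : V) : Prop :=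
  exists e, joins G e u v.

Definition incident (V E : Type) (G : graph V E) (v : V) : set E :=
  [set e | exists u, joins G e v u].

Definition loops (V E : Type) (G : graph V E) (v : V) : set E :=
  [set e | joins G e v v].

(* Loops at [v] belong to [incident G v] too, hence are counted twice. *)
Definition deg (V E : Type) (G : graph V E) (v : V) : enat :=
  enat_add (ecard (incident G v)) (ecard (loops G v)).

Definition even_degree (V E : Type) (G : graph V E) (v : V) : Prop :=
  exists2 n, deg G v = Some n & ~~ odd n.

Definition odd_degree (V E : Type) (G : graph V E) (v : V) : Prop :=
  exists2 n, deg G v = Some n & odd n.

Definition infinite_degree (V E : Type) (G : graph V E) (v : V) : Prop :=
  deg G v = None.

Definition infinite_graph (V E : Type) (G : graph V E) : Prop :=
  infinite_set (edges G).

(** * Subgraphs *)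

Definition subgraph (V E : Type) (H G : graph V E) : Prop :=
  [/\ verts H `<=` verts G, edges H `<=` edges G &
      forall e u v, edges H e -> (joins H e u v <-> joins G e u v)].

Section EdgeInduced.
Variables (V E : Type) (G : graph V E) (S : set E).

Let iverts : set V := [set v | exists e u, S e /\ joins G e v u].
Let iedges : set E := edges G `&` S.
Let ijoins (e : E) (u v : V) : Prop := S e /\ joins G e u v.

Fact induced_in e u v : ijoins e u v -> [/\ iedges e, iverts u & iverts v].
Proof.
move=> [Se j]; have [Ge _ _] := joins_in j; split=> //.
- by exists e, v.
- by exists e, u; split=> //; apply: joins_sym.
Qed.

Fact induced_ex e : iedges e -> exists u v, ijoins e u v.
Proof. by move=> [Ge Se]; have [u [v j]] := joins_ex Ge; exists u, v. Qed.

Fact induced_sym e u v : ijoins e u v -> ijoins e v u.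
Proof. by move=> [Se j]; split=> //; apply: joins_sym. Qed.

Fact induced_uniq e u v u' v' : ijoins e u v -> ijoins e u' v' ->
  (u' = u /\ v' = v) \/ (u' = v /\ v' = u).
Proof. by move=> [_ j] [_ j']; apply: joins_uniq j j'. Qed.

Definition edge_induced : graph V E :=
  Graph induced_in induced_ex induced_sym induced_uniq.

End EdgeInduced.

Definition remove_edges (V E : Type) (G : graph V E) (S : set E) : graph V E :=
  edge_induced G (edges G `\` S).

(** * Homomorphisms and paths *)

(* The underlying functions are total on the carriers, but only their values
   on [verts H] and [edges H] are meaningful.  Edges of [H] are mapped to
   edges of [G] by [joins_ex] and [joins_in]. *)
Record graph_hom (V' E' V E : Type)
    (H : graph V' E') (G : graph V E) := GraphHom {
  hom_v : V' -> V;
  hom_e : E' -> E;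
  hom_verts : forall u, verts H u -> verts G (hom_v u);
  hom_joins : forall e u v, joins H e u v ->
    joins G (hom_e e) (hom_v u) (hom_v v)
}.

Section Line.
Variables (T : Type) (s : T -> T) (A : set T).

Let ledges : set T := [set c | A c /\ A (s c)].
Let ljoins (c u v : T) : Prop :=
  ledges c /\ ((u = c /\ v = s c) \/ (u = s c /\ v = c)).

Fact line_in c u v : ljoins c u v -> [/\ ledges c, A u & A v].
Proof. by move=> [[Ac As]] [[-> ->]|[-> ->]]. Qed.

Fact line_ex c : ledges c -> exists u v, ljoins c u v.
Proof. by move=> lc; exists c, (s c); split=> //; left. Qed.

Fact line_sym c u v : ljoins c u v -> ljoins c v u.
Proof. by move=> [lc] [[-> ->]|[-> ->]]; split=> //; [right|left]. Qed.

Fact line_uniq c u v u' v' : ljoins c u v -> ljoins c u' v' ->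
  (u' = u /\ v' = v) \/ (u' = v /\ v' = u).
Proof.
by move=> [_] [[-> ->]|[-> ->]] [_] [[-> ->]|[-> ->]];
  [left|right|right|left].
Qed.

(* The graph with vertex set [A] in which [c] and [s c] are joined by a single
   edge, itself named [c], whenever both belong to [A]. *)
Definition line : graph T T := Graph line_in line_ex line_sym line_uniq.

End Line.

Definition int_segment (a b : int) : graph int int :=
  line (fun c : int => (c + 1)%R) [set c : int | (a <= c <= b)%R].

Definition nat_line : graph nat nat := line succn setT.

Definition int_line : graph int int := line (fun c : int => (c + 1)%R) setT.

Definition is_path (V' E' V E : Type) (H : graph V' E') (G : graph V E)
    (p : graph_hom H G) : Prop :=
  set_inj (edges H) (hom_e p).

Definition eulerian (V' E' V E : Type) (H : graph V' E') (G : graph V E)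
    (p : graph_hom H G) : Prop :=
  is_path p /\
  forall e, edges G e -> exists! c, edges H c /\ hom_e p c = e.

(** * Connectedness and ends *)

(* Carriers are pointed from here on: on an empty carrier of edges the trivial
   path at a vertex would not exist, homomorphisms being total. *)

Definition joined_by_path (V E : pointedType) (G : graph V E) (u v : V) :
    Prop :=
  exists (a b : int) (p : graph_hom (int_segment a b) G),
    [/\ (a <= b)%R, is_path p, hom_v p a = u & hom_v p b = v].

Definition connected_graph (V E : pointedType) (G : graph V E) : Prop :=
  forall u v, verts G u -> verts G v -> joined_by_path G u v.

Definition component (V E : pointedType) (G C : graph V E) : Prop :=
  [/\ subgraph C G, connected_graph C &
      forall D : graph V E, subgraph D G -> connected_graph D ->
        subgraph C D -> subgraph D C].

Definition nb_infinite_components (V E : pointedType) (G : graph V E) : enat :=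
  ecard [set C : graph V E | component G C /\ infinite_graph C].

(* [k] is the supremum of the numbers of infinite connected components of
   [G - S], for [S] a finite set of edges. *)
Definition number_of_ends (V E : pointedType) (G : graph V E) (k : enat) :
    Prop :=
  let ub (m : enat) := forall S : set E, finite_set S -> S `<=` edges G ->
    enat_le (nb_infinite_components (remove_edges G S)) m in
  ub k /\ forall m, ub m -> enat_le k m.

(** * The conditions for the existence of Eulerian paths *)

Definition satisfies_E1 (V E : pointedType) (G : graph V E) : Prop :=
  [/\ countable (edges G) /\ infinite_set (edges G),
      connected_graph G,
      (exists! v, verts G v /\ odd_degree G v) \/
      ((exists2 v, verts G v & infinite_degree G v) /\
       (forall v, verts G v -> ~ odd_degree G v))
    & number_of_ends G (Some 1)].

Definition satisfies_E2 (V E : pointedType) (G : graph V E) : Prop :=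
  [/\ countable (edges G) /\ infinite_set (edges G),
      connected_graph G,
      forall v, verts G v -> infinite_degree G v \/ even_degree G v,
      number_of_ends G (Some 1) \/ number_of_ends G (Some 2)
    & forall S : set E, finite_set S -> S `<=` edges G ->
        (forall v, verts (edge_induced G S) v ->
           even_degree (edge_induced G S) v) ->
        nb_infinite_components (remove_edges G S) = Some 1].

(** * Computability: mu-recursive functions *)

Inductive recfun : nat -> Type :=
| Zero k : recfun k
| Succ : recfun 1
| Proj k : 'I_k -> recfun k
| Comp m k : recfun m -> ('I_m -> recfun k) -> recfun k
| Prec k : recfun k -> recfun k.+2 -> recfun k.+1
| Mu k : recfun k.+1 -> recfun k.

(* [eval c x y]: the partial function with code [c] is defined at [x], with
   value [y]. *)
Inductive eval : forall k, recfun k -> k.-tuple nat -> nat -> Prop :=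
| eval_Zero k (x : k.-tuple nat) : eval (Zero k) x 0
| eval_Succ (x : 1.-tuple nat) : eval Succ x (thead x).+1
| eval_Proj k (i : 'I_k) (x : k.-tuple nat) : eval (Proj i) x (tnth x i)
| eval_Comp m k (g : recfun m) (h : 'I_m -> recfun k) (x : k.-tuple nat)
    (w : m.-tuple nat) y :
    (forall i, eval (h i) x (tnth w i)) -> eval g w y -> eval (Comp g h) x y
| eval_Prec0 k (g : recfun k) (h : recfun k.+2) (x : k.-tuple nat) y :
    eval g x y -> eval (Prec g h) [tuple of 0 :: x] y
| eval_PrecS k (g : recfun k) (h : recfun k.+2) (x : k.-tuple nat) n r y :
    eval (Prec g h) [tuple of n :: x] r ->
    eval h [tuple of [:: n, r & x]] y ->
    eval (Prec g h) [tuple of n.+1 :: x] y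
| eval_Mu k (g : recfun k.+1) (x : k.-tuple nat) y :
    (forall z, z < y -> exists t, eval g [tuple of z :: x] t.+1) ->
    eval g [tuple of y :: x] 0 ->
    eval (Mu g) x y.

Definition computable k (f : k.-tuple nat -> nat) : Prop :=
  exists c : recfun k, forall x, eval c x (f x).

Definition computable_nat (f : nat -> nat) : Prop :=
  computable (fun x : 1.-tuple nat => f (thead x)).

Definition computable_int (f : int -> nat) : Prop :=
  computable_nat (fun n => f (Posz n)) /\
  computable_nat (fun n => f (- Posz n)%R).

Definition decidable_set k (A : set (k.-tuple nat)) : Prop :=
  computable (fun x => (`[< A x >] : nat)).

(** * Computable graphs and paths *)

(* [vi] and [ei] give the indices of the vertices and of the edges. *)
Definition computable_graph (V E : Type) (G : graph V E)
    (vi : V -> nat) (ei : E -> nat) : Prop :=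
  (set_inj (verts G) vi /\ set_inj (edges G) ei) /\
  [/\ decidable_set [set x : 1.-tuple nat |
        exists2 v, verts G v & x = [tuple vi v]],
      decidable_set [set x : 1.-tuple nat |
        exists2 e, edges G e & x = [tuple ei e]],
      decidable_set [set x : 2.-tuple nat |
        exists u v, adjacent G u v /\ x = [tuple vi u; vi v]]
    & decidable_set [set x : 3.-tuple nat |
        exists e u v, joins G e u v /\ x = [tuple ei e; vi u; vi v]]].

Definition moderately_computable_graph (V E : Type) (G : graph V E)
    (vi : V -> nat) (ei : E -> nat) : Prop :=
  computable_graph G vi ei /\
  exists2 d : nat -> nat, computable_nat d &
    forall v, verts G v -> d (vi v) = enat_code (deg G v).

Definition computable_path1 (V E : Type) (G : graph V E)
    (vi : V -> nat) (ei : E -> nat) (p : graph_hom nat_line G) : Prop :=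
  computable_nat (fun n => vi (hom_v p n)) /\
  computable_nat (fun n => ei (hom_e p n)).

Definition computable_path2 (V E : Type) (G : graph V E)
    (vi : V -> nat) (ei : E -> nat) (p : graph_hom int_line G) : Prop :=
  computable_int (fun n => vi (hom_v p n)) /\
  computable_int (fun n => ei (hom_e p n)).

(* Main.v *)
Require Import Defs.
From mathcomp Require Import all_boot all_order all_algebra.
From mathcomp Require Import boolp classical_sets functions cardinality.
From mathcomp Require Import zify.

(** The Eulerian path is built in stages.  A stage is a finite trail (two
    trails with a common start, for a two-way path) that can be continued to an
    Eulerian path, and stage [n + 1] extends stage [n] and contains the edge
    of index [n].

    One-way paths.  Call a trail extensible when an edge remains at its end and
    all remaining edges are connected to this end.  From the end [b] of an
    extensible trail, walk along remaining edges through a prescribed edge to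
    some vertex [b'].  Beyond it, one infinite component and finitely many
    finite ones remain.  The remaining degree of [b'] is odd or infinite, and
    all others are even or infinite.  By the handshake lemma [b'] cannot lie in
    a finite component, hence lies in the infinite one; the finite components
    have even degrees and are attached to the walk, so that by Euler's theorem
    for finite graphs the walk and these components together are covered by one
    trail from [b] to [b'] ([extend1]).

    Two-way paths.  Now two trails start at [v0] and end at [a] and [b], and
    every remaining edge is connected to [a] or to [b].  After the walk from [b]
    to [b'], the handshake lemma shows that [a] and [b'] are both in infinite
    components or both in the same finite one ([extend2_left]).  In the first
    case one absorbs the finite components as before; that every infinite
    component contains [a] or [b'] follows from the bound on the number of ends
    if [a] and [b'] are not connected, and otherwise from the condition on
    finite sets of edges with even degrees, applied to the edges used so far
    completed by a trail from [a] to [b'].  In the second case the edges left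
    outside the infinite components are covered by a trail from [b] to [a]; all
    used edges now have even degrees, so that one infinite component remains,
    and cutting the trail at a vertex of this component extends the two trails
    to the same vertex.  Further extensions and exchanges of ends that coincide
    make both trails grow ([progress2]).

    Computability.  The existence of a good extension is classical, but being a
    good extension is semi-decidable: by connectedness it suffices that each
    endpoint of a used edge that still has a remaining edge be joined to an end
    by a walk along remaining edges ([certified_sound]).  The walks serve as
    certificates, and computability of the degree tells which vertices have no
    remaining edge.  An unbounded search for the next stage together with its
    certificates thus always succeeds ([computable_run]).

    Walks are handled on the codes of edges and vertices; [one_component] and
    [two_components] translate the hypotheses on ends, and [degree_parity_code]
    those on degrees. *)

Set Implicit Arguments.
Unset Strict Implicit.
Unset Printing Implicit Defensive.

Local Open Scope classical_set_scope.
Local Open Scope nat_scope.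

(** * Walks in a multigraph *)

Section Walks.
Variables (V E : eqType) (src tgt : E -> V).
Implicit Types (R Q : pred E) (x y z v w : V) (e : E) (p q r F : seq E).

Definition incident_to e x := (src e == x) || (tgt e == x).

(** Edges carry an arbitrary orientation, so that a vertex and a list of edges
    determine a walk: crossing [e] from its endpoint [x] leads to
    [opposite e x]. *)
Definition opposite e x := if src e == x then tgt e else src e.

Fixpoint is_walk R x p :=
  if p is e :: p' then [&& R e, incident_to e x & is_walk R (opposite e x) p']
    else true.

Definition walk_end x p := foldl (fun y e => opposite e y) x p.

Definition deg_in F x := \sum_(e <- F) ((src e == x) + (tgt e == x)).

Definition linked R x y := exists2 p, is_walk R x p & walk_end x p = y.

Definition nonisolated R x := exists2 e, R e & incident_to e x.

Definition visits x p z := exists i, walk_end x (take i p) = z.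

(** The component of [x] in the graph with edges [R] has infinitely many
    edges. *)
Definition infinite_at R x :=
  forall T : seq E, exists e, [/\ R e, e \notin T & linked R x (src e)].

Lemma incident_src e : incident_to e (src e). Proof.
  by rewrite /incident_to eqxx. Qed.

Lemma incident_tgt e : incident_to e (tgt e). Proof.
  by rewrite /incident_to eqxx orbT. Qed.

Lemma incident_opposite e x : incident_to e (opposite e x).
Proof. by rewrite /incident_to /opposite; case: ifP => _; rewrite eqxx ?orbT.
  Qed.

Lemma oppositeK e x : incident_to e x -> opposite e (opposite e x) = x.
Proof.
rewrite /incident_to /opposite; case: (eqVneq (src e) x) => [<-|nsx] /=.
  by move=> _; case: eqVneq.
by rewrite eqxx => /eqP.
Qed.

Lemma incident_cases e x y : incident_to e x -> incident_to e y ->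
  y = x \/ y = opposite e x.
Proof.
rewrite /incident_to /opposite; case: (eqVneq (src e) x) => [<-|nsx] /=.
  by move=> _ /orP[/eqP<-|/eqP<-]; [left|right].
by move=> /eqP<- /orP[/eqP<-|/eqP<-]; [right|left].
Qed.

Lemma walk_cat R x p q : is_walk R x (p ++ q) = is_walk R x p &&
  is_walk R (walk_end x p) q.
Proof. by elim: p x => //= e p IHp x; rewrite IHp !andbA. Qed.

Lemma walk_end_cat x p q : walk_end x (p ++ q) = walk_end (walk_end x p) q.
Proof. exact: foldl_cat. Qed.

Lemma walk_all R x p : is_walk R x p -> all R p.
Proof. by elim: p x => //= e p IHp x /and3P[-> _ /IHp]. Qed.

Lemma walk_in R x p : is_walk R x p -> forall e, e \in p -> R e.
Proof. by move=> /walk_all/allP. Qed.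

Lemma walk_sub R Q x p :
  is_walk R x p -> (forall e, e \in p -> Q e) -> is_walk Q x p.
Proof.
elim: p x => //= e p IHp x /and3P[_ -> /IHp wp] sQ.
rewrite sQ ?mem_head //=; apply: wp => f fp.
by apply: sQ; rewrite in_cons fp orbT.
Qed.

Lemma walk_edge_visits R x p e : is_walk R x p -> e \in p ->
  exists2 z, visits x p z & incident_to e z.
Proof.
elim: p x => //= f p IHp x /and3P[_ fx wp]; rewrite in_cons.
case/orP => [/eqP->|/(IHp _ wp)[z [i <-] ez]].
  by exists x => //; exists 0.
by exists (walk_end (opposite f x) (take i p)) => //; exists i.+1.
Qed.

Lemma visits_start x p : visits x p x.
Proof. by exists 0; rewrite take0. Qed.

Lemma visits_end x p : visits x p (walk_end x p).
Proof. by exists (size p); rewrite take_size. Qed.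

Lemma visits_split x p z : visits x p z ->
  exists p1 p2, p = p1 ++ p2 /\ walk_end x p1 = z.
Proof. by move=> [i <-]; exists (take i p), (drop i p); rewrite cat_take_drop.
  Qed.

Lemma visits_incident R x p e z : is_walk R x p -> e \in p ->
  incident_to e z -> visits x p z.
Proof.
elim: p x => //= f p IHp x /and3P[_ fx wp]; rewrite in_cons.
case/orP => [/eqP->|ep ez].
  move=> /(incident_cases fx)[->|->]; first exact: visits_start.
  by exists 1; rewrite /= take0.
by have [i <-] := IHp _ wp ep ez; exists i.+1.
Qed.

Lemma visits_cases R x p z : is_walk R x p -> visits x p z ->
  z = x \/ exists2 e, e \in p & incident_to e z.
Proof.
move=> wp /visits_split[p1 [p2 [def_p <-]]]; move: wp; rewrite def_p.
case/lastP: p1 {def_p} => [|p1 e] _; first by left.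
right; exists e; first by rewrite mem_cat mem_rcons mem_head.
by rewrite -cats1 walk_end_cat /= incident_opposite.
Qed.

Lemma walk_rev R x p : is_walk R x p ->
  is_walk R (walk_end x p) (rev p) /\ walk_end (walk_end x p) (rev p) = x.
Proof.
elim: p x => //= e p IHp x /and3P[Re ex /IHp[wp dp]].
by rewrite rev_cons -cats1 walk_cat walk_end_cat /= wp dp Re incident_opposite
  oppositeK.
Qed.

Lemma linked_refl R x : linked R x x. Proof. by exists [::]. Qed.

Lemma linked_sym R x y : linked R x y -> linked R y x.
Proof. by move=> [p /walk_rev[wp dp] <-]; exists (rev p). Qed.

Lemma linked_trans R y x z : linked R x y -> linked R y z -> linked R x z.
Proof.
move=> [p wp <-] [q wq <-]; exists (p ++ q); last exact: walk_end_cat.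
by rewrite walk_cat wp.
Qed.

Lemma linked_edge R e x y : R e -> incident_to e x -> incident_to e y ->
  linked R x y.
Proof.
move=> Re ex /(incident_cases ex)[->|->]; first exact: linked_refl.
by exists [:: e]; rewrite //= Re ex.
Qed.

Lemma linked_sub R Q x y : (forall e, R e -> Q e) -> linked R x y ->
  linked Q x y.
Proof.
move=> sRQ [p wp <-]; exists p => //; apply: (walk_sub wp) => e.
by move/(walk_in wp)/sRQ.
Qed.

Lemma linked_nonisolated R x y : linked R x y -> x = y \/ nonisolated R y.
Proof.
move=> [p]; case/lastP: p => [|p e] /=; first by left.
rewrite -cats1 walk_cat walk_end_cat /= => /and3P[_ Re _] <-.
by right; exists e; rewrite ?incident_opposite // (andP Re).1.
Qed.

(** Repeated edges are shortcut one at a time: if [e] leaves [x] and is used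
    again later, the walk can start just after, or with, that use. *)
Lemma linked_trail R x y : linked R x y ->
  exists p, [/\ is_walk R x p, uniq p & walk_end x p = y].
Proof.
move=> [p wp <-{y}].
elim: p x wp => [|e p IHp] x /=; first by exists [::].
case/and3P=> Re ex /IHp[q [wq uq <-]].
have [eq|neq] := boolP (e \in q); last first.
  by exists (e :: q); rewrite /= Re ex wq neq uq.
case/splitPr: eq wq uq => q1 q2.
rewrite walk_cat walk_end_cat cat_uniq /= => /and4P[_ _ ez wq2] /and3P[_ _
  /andP[nq2 uq2]].
move: wq2; case: (incident_cases ex ez) => -> wq2.
  by exists (e :: q2); rewrite /= Re ex nq2.
by rewrite oppositeK // in wq2 *; exists q2.
Qed.

(** Each edge passed contributes one to the degree of the vertex that it leaves
    and one to the degree of the vertex that it enters. *)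
Lemma odd_deg_walk R x p v :
  is_walk R x p -> odd (deg_in p v) = (x == v) (+) (walk_end x p == v).
Proof.
elim: p x => [|e p IHp] x /=; first by rewrite /deg_in big_nil addbb.
case/and3P=> _ ex /IHp; rewrite /deg_in big_cons oddD => ->.
have -> : odd ((src e == v) + (tgt e == v)) = (x == v) (+) (opposite e x == v).
  move: ex; rewrite oddD !oddb /incident_to /opposite.
  by case: (eqVneq (src e) x) => [<-|_] //= /eqP->; rewrite addbC.
by rewrite addbA -(addbA (x == v)) addbb addbF.
Qed.

Lemma deg_in_cat p q v : deg_in (p ++ q) v = deg_in p v + deg_in q v.
Proof. exact: big_cat. Qed.

Lemma deg_in_perm p q v : perm_eq p q -> deg_in p v = deg_in q v.
Proof. exact: perm_big. Qed.

Lemma deg_in_eq0 p v : (forall e, e \in p -> ~~ incident_to e v) ->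
  deg_in p v = 0.
Proof.
move=> H; rewrite /deg_in big_seq big1 // => e /H.
by rewrite /incident_to negb_or => /andP[/negbTE-> /negbTE->].
Qed.

Lemma perm_diff p F : uniq p -> uniq F -> {subset p <= F} ->
  perm_eq F (p ++ [seq e <- F | e \notin p]).
Proof.
move=> up uF spF; apply: uniq_perm => //.
  rewrite cat_uniq up filter_uniq // andbT /=; apply/hasPn => e.
  by rewrite mem_filter => /andP[].
move=> e; rewrite mem_cat mem_filter.
by have [/spF|] := boolP (e \in p).
Qed.

Lemma deg_in_full p F v : uniq p -> uniq F -> {subset p <= F} ->
  (forall e, e \in F -> incident_to e v -> e \in p) -> deg_in p v = deg_in F v.
Proof.
move=> up uF spF full; rewrite (deg_in_perm v (perm_diff up uF spF)) deg_in_cat.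
rewrite [X in _ + X]deg_in_eq0 ?addn0 // => e; rewrite mem_filter =>
  /andP[nep eF].
by apply: contraNN nep; apply: full.
Qed.

(** The degrees add up to twice the number of edges. *)
Lemma handshake F v : (forall w, odd (deg_in F w) = (w == v)) -> False.
Proof.
move=> Hodd; pose vs := undup (v :: map src F ++ map tgt F).
have vvs : v \in vs by rewrite mem_undup mem_head.
have : odd (\sum_(w <- vs) deg_in F w) = true.
  rewrite (perm_big _ (perm_to_rem vvs)) big_cons oddD Hodd eqxx.
  rewrite (big_morph odd oddD (erefl _)) big_seq big1 // => w.
  by rewrite Hodd rem_filter ?undup_uniq // mem_filter => /andP[/negbTE].
have -> : \sum_(w <- vs) deg_in F w = \sum_(e <- F) 2.
  rewrite exchange_big /= big_seq [RHS]big_seq; apply: eq_bigr => e eF.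
  have one z : z \in vs -> \sum_(w <- vs) (z == w) = 1.
    move=> zvs; rewrite (perm_big _ (perm_to_rem zvs)) big_cons eqxx big_seq.
    rewrite big1 // => w; rewrite rem_filter ?undup_uniq // mem_filter /=.
    by rewrite eq_sym => /andP[/negbTE->].
  by rewrite big_split /= !one // mem_undup in_cons mem_cat map_f ?orbT.
by rewrite big_const_seq count_predT iter_addn_0 mul2n odd_double.
Qed.

Lemma max_trail F x : exists p,
  [/\ is_walk (mem F) x p, uniq p & forall e, e \in F ->
    incident_to e (walk_end x p) -> e \in p].
Proof.
suff: forall n p, is_walk (mem F) x p -> uniq p -> size F <= size p + n ->
    exists p, [/\ is_walk (mem F) x p, uniq p &
      forall e, e \in F -> incident_to e (walk_end x p) -> e \in p].
  by move/(_ (size F) [::]); apply.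
elim=> [|n IHn] p wp up lepn.
  exists p; split=> // e eF _; rewrite addn0 in lepn.
  by have [_ ->] := uniq_min_size up (walk_in wp) lepn.
have [[e [eF ed nep]]|H] := pselect (exists e, [/\ e \in F,
  incident_to e (walk_end x p) & e \notin p]).
  apply: (IHn (rcons p e)); last by rewrite size_rcons addSnnS.
    by rewrite -cats1 walk_cat wp /= eF ed.
  by rewrite rcons_uniq nep.
exists p; split=> // e eF ed; apply/negPn/negP => nep.
by apply: H; exists e.
Qed.

(** Where a maximal trail stops, it has used all edges of [F] at that vertex, so
    that the two degrees there have the same parity; this leaves only [y]. *)
Lemma max_trail_end F x y : uniq F ->
  (forall w, odd (deg_in F w) = (x == w) (+) (y == w)) ->
  exists p, [/\ is_walk (mem F) x p, uniq p, walk_end x p = y &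
    forall e, e \in F -> incident_to e y -> e \in p].
Proof.
move=> uF Hodd; have [p [wp up fullp]] := max_trail F x.
have dpy : walk_end x p = y.
  have := odd_deg_walk (walk_end x p) wp.
  rewrite (deg_in_full up uF (walk_in wp) fullp) Hodd eqxx.
  by move/addbI/eqP.
by exists p; rewrite -dpy.
Qed.

(** Euler's theorem for finite graphs: as long as edges are unused, one of them
    meets the trail, and since unused degrees are even a maximal trail through
    unused edges closes up and can be spliced in. *)
Lemma finite_euler F x y : uniq F ->
  (forall w, odd (deg_in F w) = (x == w) (+) (y == w)) ->
  (forall e, e \in F -> linked (mem F) x (src e)) ->
  exists p, [/\ is_walk (mem F) x p, walk_end x p = y & perm_eq p F].
Proof.
move=> uF Hodd Hconn.
have [p0 [wp0 up0 dp0 _]] := max_trail_end uF Hodd.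
suff: forall n p, is_walk (mem F) x p -> uniq p -> walk_end x p = y ->
    size F <= size p + n ->
    exists p, [/\ is_walk (mem F) x p, walk_end x p = y & perm_eq p F].
  by move/(_ (size F) p0 wp0 up0 dp0); apply; apply: leq_addl.
elim=> [|n IHn] p wp up dp lepn.
  exists p; split=> //; apply: uniq_perm => //; rewrite addn0 in lepn.
  by have [] := uniq_min_size up (walk_in wp) lepn.
have [[e [eF nep]]|H] := pselect (exists e, e \in F /\ e \notin p); last first.
  exists p; split=> //; apply: uniq_perm => // e.
  apply/idP/idP => [|eF]; first exact: (walk_in wp).
  by apply/negPn/negP => nep; apply: H; exists e.
(* the first unused edge on a walk towards [e] leaves from the trail *)
have [z [f [zp fF nfp fz]]] :
    exists z f, [/\ visits x p z, f \in F, f \notin p & incident_to f z].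
  have [q] := Hconn e eF.
  suff: forall u, visits x p u -> is_walk (mem F) u q -> walk_end u q = src e ->
      exists z f, [/\ visits x p z, f \in F, f \notin p & incident_to f z].
    by apply; apply: visits_start.
  elim: q => [|f q IHq] u up' /=.
    by move=> _ eu; exists u, e; split=> //; rewrite /incident_to eu eqxx.
  case/and3P=> fF fu wq dq; have [fp|nfp] := boolP (f \in p).
    apply: (IHq (opposite f u)) => //.
    by apply: (visits_incident wp fp); apply: incident_opposite.
  by exists u, f.
have [p1 [p2 [def_p dp1]]] := visits_split zp.
pose F' := [seq e <- F | e \notin p].
have pF : perm_eq F (p ++ F') := perm_diff up uF (walk_in wp).
have HF' w : odd (deg_in F' w) = (z == w) (+) (z == w).
  have := Hodd w; rewrite (deg_in_perm w pF) deg_in_cat oddD (odd_deg_walk _ wp)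
    dp.
  by rewrite addbb; case: (x == w); case: (y == w); case: odd.
have [q [wq uq dq fullq]] := max_trail_end (filter_uniq _ uF) HF'.
have fq : f \in q by apply: fullq => //; rewrite mem_filter nfp.
have wpq : is_walk (mem F) x (p1 ++ q ++ p2).
  move: wp; rewrite def_p !walk_cat => /andP[-> wp2] /=.
  rewrite dp1 dq -{2}dp1 wp2 andbT; apply: (walk_sub wq) => g.
  by move/(walk_in wq); rewrite /= mem_filter => /andP[].
apply: (IHn _ wpq).
- rewrite -(perm_uniq (_ : perm_eq (p ++ q) _)); last first.
    by rewrite def_p -catA perm_cat2l perm_catC.
  rewrite cat_uniq up uq andbT; apply/hasPn => g /(walk_in wq).
  by rewrite /= mem_filter => /andP[].
- by rewrite !walk_end_cat dp1 dq -dp1 -walk_end_cat -def_p.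
have q0 : 0 < size q by case: (q) fq.
by move: lepn q0; rewrite def_p !size_cat; clear; lia.
Qed.

Lemma finite_component R x : ~ infinite_at R x -> exists2 C : seq E, uniq C &
  forall e, e \in C <-> R e /\ linked R x (src e).
Proof.
move=> /existsNP[T HT].
exists (undup [seq e <- T | `[< R e /\ linked R x (src e) >]]);
  first exact: undup_uniq.
move=> e; rewrite mem_undup mem_filter; split=> [/andP[/asboolP]//|H].
rewrite asboolT //=; apply/negPn/negP => neT.
by apply: HT; exists e; case: H.
Qed.

End Walks.

(** * Removing finitely many edges *)

Section Extension.
Variables (V E : eqType) (src tgt : E -> V) (ed : pred E).

Local Notation inc := (incident_to src tgt).
Local Notation other := (opposite src tgt).
Local Notation walk := (is_walk src tgt).
Local Notation dst := (walk_end src tgt).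
Local Notation dg := (deg_in src tgt).
Local Notation conn := (linked src tgt).
Local Notation live := (nonisolated src tgt).
Local Notation visits := (visits src tgt).
Local Notation infc := (infinite_at src tgt).

Implicit Types (R Q : pred E) (x y z v w : V) (e : E) (p q r F T : seq E).

Definition avoiding T : pred E := fun e => ed e && (e \notin T).

(** [par] prescribes the parities of the finite degrees; the first alternative
    is that the degree of [v] is infinite. *)
Definition degree_parity (par : V -> bool) := forall v,
  (forall T, exists e, [/\ ed e, e \notin T & inc e v]) \/
  exists L, [/\ uniq L, forall e, e \in L <-> ed e /\ inc e v
              & odd (dg L v) = par v].

Local Notation Rm := avoiding.

Variable par : V -> bool.

Hypothesis edge_conn : forall x y, live ed x -> live ed y -> conn ed x y.
Hypothesis deg_par : degree_parity par.

Lemma linked_src R x e : R e -> inc e x -> conn R x (src e).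
Proof. by move=> Re ex; apply: linked_edge Re ex (incident_src _ _ _). Qed.

Lemma infinite_at_linked R x y : infc R x -> conn R x y -> infc R y.
Proof.
move=> ix xy T; have [e [Re neT xe]] := ix T; exists e; split=> //.
exact: linked_trans (linked_sym xy) xe.
Qed.

Lemma infinite_at_nonisolated R x : infc R x -> live R x.
Proof.
move=> /(_ [::])[e [Re _ /linked_sym/linked_nonisolated[<-|//]]].
by exists e; rewrite ?incident_src.
Qed.

(** Having finitely many edges in [T] and finitely many outside, [v] has a
    finite degree, which splits between [T] and [C]. *)
Lemma odd_deg_rest T C v : uniq T -> all ed T -> uniq C ->
  (forall e, e \in C -> Rm T e) ->
  (forall e, Rm T e -> inc e v -> e \in C) ->
  odd (dg C v) = par v (+) odd (dg T v).
Proof.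
move=> uT /allP edT uC CT full; case: (deg_par v) =>
  [/(_ (C ++ T))|[L [uL HL <-]]].
  move=> [e []]; rewrite mem_cat negb_or => ee /andP[neC neT] ev.
  by rewrite full // /Rm ee in neC.
have -> : dg L v = dg (T ++ C) v.
  apply: deg_in_full => //.
  - rewrite cat_uniq uT uC andbT; apply/hasPn => e /CT.
    by case/andP.
  - move=> e /HL[ee ev]; rewrite mem_cat.
    by have [//|neT] := boolP (e \in T); apply: full; rewrite // /Rm ee.
  move=> e; rewrite mem_cat HL => /orP[/edT//|/CT/andP[]] //.
by rewrite deg_in_cat oddD addbC addbA addbb.
Qed.

Lemma odd_deg_component T C x w : uniq T -> all ed T -> uniq C ->
  (forall e, e \in C <-> Rm T e /\ conn (Rm T) x (src e)) ->
  odd (dg C w) = `[< conn (Rm T) x w >] && (par w (+) odd (dg T w)).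
Proof.
move=> uT eT uC HC; case: asboolP => [xw|nxw] /=.
  apply: odd_deg_rest => // e; first by case/HC.
  by move=> Re ew; apply/HC; split=> //; apply: linked_trans xw (linked_src Re
    ew).
rewrite deg_in_eq0 // => e /HC[Re xe]; apply/negP => ew; apply: nxw.
exact: linked_trans xe (linked_sym (linked_src Re ew)).
Qed.

(** This locates the vertices whose remaining degree is odd: once the edges of a
    trail are removed, these parities are known, and a finite component does not
    contain just one odd vertex. *)
Lemma component_handshake T x : uniq T -> all ed T -> ~ infc (Rm T) x ->
  (forall w, conn (Rm T) x w -> par w (+) odd (dg T w) = (w == x)) -> False.
Proof.
move=> uT eT fx Hodd; have [C uC HC] := finite_component fx;
  apply: (@handshake _ _ src tgt C x) => w.
rewrite (odd_deg_component _ uT eT uC HC); case: asboolP => [/Hodd//|nxw] /=.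
by apply/esym/negbTE; apply: contra_notN nxw => /eqP->; apply: linked_refl.
Qed.

(** The walk is followed up to its first vertex in [P]; until then it runs
    through edges in [Q]. *)
Lemma first_hit R Q (P : V -> Prop) x y :
  (forall e, R e -> Q e \/ (forall z, inc e z -> P z)) ->
  conn R x y -> conn Q x y \/ exists2 z, P z & conn Q x z.
Proof.
move=> H [p wp <-]; elim: p x wp => [|e p IHp] x /=.
  by move=> _; left; apply: linked_refl.
case/and3P=> Re ex /IHp IH; have [Qe|Pe] := H e Re; last first.
  by right; exists x; [apply: Pe|apply: linked_refl].
have xo : conn Q x (other e x) := linked_edge Qe ex (incident_opposite _ _ _ _).
case: IH => [oy|[z Pz oz]]; first by left; apply: linked_trans xo oy.
by right; exists z => //; apply: linked_trans xo oz.
Qed.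

Lemma finite_components_union R (vs : seq V) : exists C : seq E, forall z,
  z \in vs ->
  ~ infc R z -> forall e, R e -> conn R z (src e) -> e \in C.
Proof.
elim: vs => [|v vs [C HC]]; first by exists [::].
have [iv|fv] := pselect (infc R v).
  exists C => z; rewrite in_cons => /orP[/eqP->//|]; exact: HC.
have [D _ HD] := finite_component fv.
exists (D ++ C) => z; rewrite in_cons => /orP[/eqP-> _ e Re ve|zvs fz e Re ze].
  by rewrite mem_cat (_ : e \in D) //; apply/HD.
by rewrite mem_cat (HC z) ?orbT.
Qed.

Definition endpoints T := map src T ++ map tgt T.

Lemma mem_endpoints T e z : e \in T -> inc e z -> z \in endpoints T.
Proof.
move=> eT /orP[/eqP<-|/eqP<-]; rewrite mem_cat map_f ?orbT //.
Qed.

Lemma avoiding_cat p T e : Rm (p ++ T) e = Rm T e && (e \notin p).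
Proof. by rewrite /Rm mem_cat negb_or -andbA (andbC (e \notin p)). Qed.

(** The edges of all finite components left by the removal of [T]. *)
Definition finite_part T F :=
  uniq F /\ forall e, e \in F <-> Rm T e /\ ~ infc (Rm T) (src e).

(** As the graph is connected, each component left by the removal of [T]
    contains an endpoint of an edge in [T]; so there are finitely many. *)
Lemma finite_part_ex T e0 : e0 \in T -> ed e0 -> exists F, finite_part T F.
Proof.
move=> e0T ee0; have [C HC] := finite_components_union (Rm T) (endpoints T).
exists (undup [seq e <- C | `[< Rm T e /\ ~ infc (Rm T) (src e) >]]).
split=> [|e]; first exact: undup_uniq.
rewrite mem_undup mem_filter; split=> [/andP[/asboolP]//|H].
rewrite asboolT //=; case: H => Re fe; have ee := (andP Re).1.
have : conn ed (src e) (src e0).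
  by apply: edge_conn; [exists e|exists e0]; rewrite ?incident_src.
have se0 : src e0 \in endpoints T by apply: mem_endpoints e0T (incident_src _ _
  _).
suff hit z : z \in endpoints T -> conn (Rm T) (src e) z -> e \in C.
  case/(@first_hit _ (Rm T) (fun z => z \in endpoints T)) => [f ef||[z]].
  - have [fT|nfT] := boolP (f \in T); last by left; rewrite /Rm ef.
    by right=> z; apply: mem_endpoints fT.
  - exact: hit.
  - exact: hit.
move=> zT ez; apply: HC zT _ _ Re (linked_sym ez) =>
  /infinite_at_linked/(_ (linked_sym ez)).
exact: fe.
Qed.

(** The component of [x] falls into pieces that contain [x] or an endpoint of an
    edge in [r].  Were all these pieces finite, so would be the component. *)
Lemma infinite_at_removal T r x : infc (Rm T) x ->
  exists2 y, conn (Rm T) x y & infc (Rm (r ++ T)) y.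
Proof.
move=> ix; apply: contrapT => /forall2NP H.
have [C HC] := finite_components_union (Rm (r ++ T)) (x :: endpoints r).
have [e [Re]] := ix (r ++ C); rewrite mem_cat negb_or => /andP[ner neC] xe.
have Re' : Rm (r ++ T) e by rewrite avoiding_cat Re.
suff hit z : z \in x :: endpoints r -> conn (Rm (r ++ T)) (src e) z -> False.
  have: forall f, Rm T f -> Rm (r ++ T) f \/
      (forall z, inc f z -> z \in x :: endpoints r).
    move=> f Rf; have [fr|nfr] := boolP (f \in r); last by left;
      rewrite avoiding_cat Rf.
    by right=> z fz; rewrite in_cons (mem_endpoints fr fz) orbT.
  move=> /first_hit/(_ (linked_sym xe))[|[z]].
    by apply: hit; apply: mem_head.
  exact: hit.
move=> zr ez; apply: (negP neC); apply: HC zr _ _ Re' (linked_sym ez).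
case: (H z) => // nxz _; apply: nxz; apply: linked_trans xe _.
by apply: linked_sub ez => f; rewrite avoiding_cat => /andP[].
Qed.

(** Removing the finite components as well leaves the infinite ones intact. *)
Section FinitePart.
Variables (T T' F : seq E).
Hypothesis finF : finite_part T F.
Hypothesis T'E : forall e, (e \in T') = (e \in T) || (e \in F).

Lemma odd_deg_finite_part w : uniq T -> all ed T -> 
  odd (dg F w) = ~~ `[< infc (Rm T) w >] && (par w (+) odd (dg T w)).
Proof.
move=> uT eT; case: finF => uF HF; case: asboolP => [iw|fw] /=.
  rewrite deg_in_eq0 // => e /HF[Re fe]; apply/negP => ew; apply: fe.
  exact: infinite_at_linked iw (linked_src Re ew).
apply: odd_deg_rest => // e; first by case/HF.
move=> Re ew; apply/HF; split=> // ie; apply: fw.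
exact: infinite_at_linked ie (linked_sym (linked_src Re ew)).
Qed.

Lemma avoiding_finite_part e : Rm T' e = Rm T e && (e \notin F).
Proof. by rewrite /Rm T'E negb_or andbA. Qed.

Lemma infinite_at_avoiding e : Rm T e -> infc (Rm T) (src e) -> Rm T' e.
Proof. by move=> Re ie; rewrite avoiding_finite_part Re /=; apply/negP =>
  /finF.2[]. Qed.

Lemma linked_finite_part x y : infc (Rm T) x -> conn (Rm T) x y ->
  conn (Rm T') x y.
Proof.
move=> ix [p]; elim: p x ix => [|e p IHp] x ix /=.
  by move=> _ <-; apply: linked_refl.
case/and3P=> Re ex wp dp; have xe := linked_src Re ex.
have Re' : Rm T' e by apply: infinite_at_avoiding Re (infinite_at_linked ix xe).
apply: linked_trans (linked_edge Re' ex (incident_opposite _ _ _ _)) (IHp _ _ wp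
  dp).
exact: infinite_at_linked ix (linked_edge Re ex (incident_opposite _ _ _ _)).
Qed.

Lemma infinite_at_finite_part x : infc (Rm T) x -> infc (Rm T') x.
Proof.
move=> ix U; have [e [Re neU xe]] := ix U; exists e; split=> //.
  exact: infinite_at_avoiding Re (infinite_at_linked ix xe).
exact: linked_finite_part.
Qed.

Lemma nonisolated_finite_part x : live (Rm T') x -> infc (Rm T) x.
Proof.
move=> [e]; rewrite avoiding_finite_part => /andP[Re neF] ex.
have [//|fx] := pselect (infc (Rm T) x); case/negP: neF; apply/finF.2.
split=> // ie; apply: fx; exact: infinite_at_linked ie (linked_sym (linked_src
  Re ex)).
Qed.

End FinitePart.

(** The walk [p] and the finite components attached to it form a connected
    finite graph, to which Euler's theorem applies. *)
Lemma absorb_finite_part T b p y F : walk (Rm T) b p -> uniq p ->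
  finite_part (p ++ T) F ->
  (forall w, odd (dg F w) = (dst b p == w) (+) (y == w)) ->
  (forall e, e \in F ->
     exists2 z, visits b p z & conn (Rm (p ++ T)) z (src e)) ->
  exists r, [/\ walk (Rm T) b r, dst b r = y & perm_eq r (p ++ F)].
Proof.
move=> wp up [uF HF] Hodd Htouch; have RF e : e \in F -> Rm T e && (e \notin p).
  by case/HF; rewrite avoiding_cat.
have bz z : visits b p z -> conn (mem (p ++ F)) b z.
  move=> /visits_split[p1 [p2 [def_p <-]]]; exists p1 => //.
  move: wp; rewrite def_p walk_cat => /andP[wp1 _].
  by apply: (walk_sub wp1) => e ep1; rewrite /= !mem_cat ep1.
have [|w|e|r [wr dr pr]] := @finite_euler _ _ src tgt (p ++ F) b y.
- by rewrite cat_uniq up uF andbT; apply/hasPn => e /RF/andP[].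
- rewrite deg_in_cat oddD Hodd (odd_deg_walk _ wp).
  by rewrite addbA -(addbA (b == w)) addbb addbF.
- rewrite mem_cat => /orP[ep|eF].
    have [z /bz cz ez] := walk_edge_visits wp ep; apply: linked_trans cz _.
    by apply: linked_src => //=; rewrite mem_cat ep.
  have [z /bz cz] := Htouch e eF; move=> /linked_sym[q wq dq].
  have [Re fe] := (HF e).1 eF.
  apply: linked_trans cz (linked_sym _); exists q => //.
  elim: q (src e) fe {dq} wq => //= f q IHq x fx /and3P[Rf fx' wq].
  rewrite fx' mem_cat (_ : f \in F) ?orbT /=; last first.
    by apply/HF; split=> // /infinite_at_linked/(_ (linked_sym (linked_src Rf
      fx'))).
  apply: IHq wq => /infinite_at_linked ifx; apply: fx; apply: ifx.
  exact: linked_edge Rf (incident_opposite _ _ _ _) fx'.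
exists r; split=> //; apply: (walk_sub wr) => e /(walk_in wr) /=.
by rewrite mem_cat => /orP[/(walk_in wp)//|/RF/andP[]].
Qed.

(** A walk that never meets [p] does not use its edges. *)
Lemma linked_or_visited T b p c x : walk (Rm T) b p -> conn (Rm T) c x ->
  conn (Rm (p ++ T)) c x \/
  exists2 z, visits b p z & conn (Rm (p ++ T)) z x.
Proof.
move=> wp /linked_sym cx.
have: forall e, Rm T e -> Rm (p ++ T) e \/ (forall z, inc e z -> visits b p z).
  move=> e Re; have [ep|nep] := boolP (e \in p); last by left;
    rewrite avoiding_cat Re.
  by right=> z; apply: visits_incident wp ep.
by move=> /first_hit/(_ cx)[/linked_sym|[z vz /linked_sym]]; [left|right;
  exists z].
Qed.

Lemma trail_through T b e0 : Rm T e0 -> conn (Rm T) b (src e0) ->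
  exists p, [/\ walk (Rm T) b p, uniq p & e0 \in p].
Proof.
move=> Re /linked_trail[p [wp up dp]]; have [ep|nep] := boolP (e0 \in p).
  by exists p.
exists (rcons p e0); rewrite rcons_uniq nep mem_rcons mem_head; split=> //.
by rewrite -cats1 walk_cat wp dp /= Re incident_src.
Qed.

End Extension.

(** * Extending trails *)

Section Trails.
Variables (V E : eqType) (src tgt : E -> V) (ed : pred E) (v0 : V).

Local Notation inc := (incident_to src tgt).
Local Notation walk := (is_walk src tgt).
Local Notation dst := (walk_end src tgt).
Local Notation dg := (deg_in src tgt).
Local Notation conn := (linked src tgt).
Local Notation live := (nonisolated src tgt).
Local Notation visits := (visits src tgt).
Local Notation infc := (infinite_at src tgt).
Local Notation Rm := (avoiding ed).
Local Notation degree_parity := (degree_parity src tgt ed).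

Implicit Types (x y z v w : V) (e : E) (p q r f g F T : seq E).

Hypothesis edge_conn : forall x y, live ed x -> live ed y -> conn ed x y.
Hypothesis edge_inf : forall T, exists2 e, ed e & e \notin T.

Lemma walk_avoiding x T p : walk (Rm T) x p -> walk ed x p.
Proof. by move=> wp; apply: (walk_sub wp) => e /(walk_in wp)/andP[]. Qed.

Lemma nonisolated_src T e : Rm T e -> live (Rm T) (src e).
Proof. by exists e; rewrite ?incident_src. Qed.

Section OneWay.
Hypothesis parity : degree_parity (fun w => v0 == w).
Hypothesis one_end : forall T x y,
  infc (Rm T) x -> infc (Rm T) y -> conn (Rm T) x y.

(** The trails from [v0] that are initial segments of one-way Eulerian paths:
    what remains is a connected graph with an edge at the end of the trail. *)
Definition extensible1 f :=
  [/\ walk ed v0 f, uniq f, live (Rm f) (dst v0 f) &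
      forall x, live (Rm f) x -> conn (Rm f) (dst v0 f) x].

(** If finite, the remaining degree of the new end [b'] is odd, and it is the
    only odd one; so [b'] is in the infinite component, and the finite ones can
    be absorbed. *)
Lemma extend1 f e0 : extensible1 f -> Rm f e0 -> exists2 q,
  extensible1 (f ++ q) & e0 \in q.
Proof.
move=> [wf uf lb cb] Re0; set b := dst v0 f in lb cb *.
have [p [wp up e0p]] := trail_through Re0 (cb _ (nonisolated_src Re0)).
pose T := p ++ f; have wfp : walk ed v0 (f ++ p) by rewrite walk_cat wf
  (walk_avoiding wp).
have uT : uniq T.
  rewrite cat_uniq up uf andbT; apply/hasPn => e ef; apply/negP =>
    /(walk_in wp).
  by rewrite /Rm ef andbF.
have eT : all ed T by move: (walk_all wfp); rewrite !all_cat andbC.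
have [F finF] : exists F, finite_part src tgt ed T F.
  by apply: (finite_part_ex edge_conn (e0 := e0));
    rewrite ?mem_cat ?e0p ?(andP Re0).1.
set b' := dst b p.
have oT w : (v0 == w) (+) odd (dg T w) = (b' == w).
  rewrite deg_in_cat addnC -deg_in_cat (odd_deg_walk _ wfp) walk_end_cat addbA
    addbb.
  by rewrite addFb.
have ib' : infc (Rm T) b'.
  apply: contrapT => /(component_handshake parity uT eT); apply=> w _.
  by rewrite oT eq_sym.
have [w|e eF|r [wr dr pr]] := absorb_finite_part (y := b') wp up finF.
- rewrite (odd_deg_finite_part parity finF w uT eT) oT addbb.
  by case: eqVneq => [<-|_]; rewrite ?andbF // asboolT.
- have Re : Rm f e.
    by have [/(_ eF)] := finF.2 e; rewrite avoiding_cat => -[/andP[]].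
  have [h|[z]] := linked_or_visited wp (cb _ (nonisolated_src Re));
    last by exists z.
  by exists b => //; apply: visits_start.
have memr e : (e \in f ++ r) = (e \in T) || (e \in F).
  rewrite !mem_cat (perm_mem pr) mem_cat.
  by case: (e \in p); case: (e \in f); case: (e \in F).
exists r; last by rewrite (perm_mem pr) mem_cat e0p.
have db' : dst v0 (f ++ r) = b' by rewrite walk_end_cat.
split; rewrite ?db'.
- by rewrite walk_cat wf (walk_avoiding wr).
- rewrite cat_uniq uf (perm_uniq pr) cat_uniq up finF.1 andbT; apply/and3P;
    split=> //.
    by apply/hasPn => e /(walk_in wr)/andP[].
  apply/hasPn => e eF; have [/(_ eF)] := finF.2 e.
  by rewrite avoiding_cat => -[/andP[]].
- by apply: infinite_at_nonisolated; apply: (infinite_at_finite_part finF memr).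
move=> x lx; have ix := nonisolated_finite_part finF memr lx.
by apply: (linked_finite_part finF memr) => //; apply: one_end.
Qed.

Lemma progress1 f e0 : extensible1 f -> ed e0 ->
  exists q, [/\ extensible1 (f ++ q), e0 \in f ++ q & q != [::]].
Proof.
move=> gf ee0; have [e Re _] : live (Rm f) (dst v0 f) by case: gf.
have [q gq eq] := extend1 gf Re.
have q0 : q != [::] by case: (q) eq.
have [e0q|ne0q] := boolP (e0 \in f ++ q); first by exists q.
have [|r gr e0r] := extend1 (e0 := e0) gq; first by rewrite /avoiding ee0.
exists (q ++ r); rewrite catA; split=> //; first by rewrite mem_cat e0r orbT.
by case: (q) q0.
Qed.

End OneWay.

Section TwoWay.
Hypothesis parity : degree_parity (fun=> false).
Hypothesis two_ends : forall T x y z,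
  infc (Rm T) x -> infc (Rm T) y -> infc (Rm T) z ->
  [\/ conn (Rm T) x y, conn (Rm T) x z | conn (Rm T) y z].
Hypothesis even_one_end : forall T x y, uniq T -> all ed T ->
  (forall w, ~~ odd (dg T w)) ->
  infc (Rm T) x -> infc (Rm T) y -> conn (Rm T) x y.

(** Two trails from [v0] that form a segment of a two-way Eulerian path.  What
    remains may have two components, one at each end. *)
Definition extensible2 f g :=
  [/\ walk ed v0 f /\ walk ed v0 g, uniq (f ++ g),
      live (Rm (f ++ g)) (dst v0 f) /\ live (Rm (f ++ g)) (dst v0 g) &
      forall x, live (Rm (f ++ g)) x ->
        conn (Rm (f ++ g)) (dst v0 f) x \/ conn (Rm (f ++ g)) (dst v0 g) x].

Lemma eq_avoiding T T' : T =i T' -> Rm T =1 Rm T'.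
Proof. by move=> TT' e; rewrite /avoiding TT'. Qed.

Lemma extensible2C f g : extensible2 f g -> extensible2 g f.
Proof.
rewrite /extensible2; have -> : Rm (f ++ g) = Rm (g ++ f).
  by apply/funext/eq_avoiding => e; rewrite !mem_cat orbC.
move=> [[? ?] u [? ?] c]; split=> //; first by rewrite uniq_catC.
by move=> x /c[]; [right|left].
Qed.

Lemma odd_deg_two f g w : walk ed v0 f -> walk ed v0 g ->
  odd (dg (f ++ g) w) = (dst v0 f == w) (+) (dst v0 g == w).
Proof.
move=> wf wg; rewrite deg_in_cat oddD (odd_deg_walk _ wf) (odd_deg_walk _ wg).
by case: (v0 == w); case: eqP; case: eqP.
Qed.

(** Let [a] and [b] be the ends of [g] and [f].  The walk from [b] through [e0]
    ends at [b'].  If [a] and [b'] are in infinite components, the finite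
    components are absorbed and [f] is extended to [b'].  Otherwise [a] and [b']
    are in one finite component; a trail from [b] to [a] covers all finite
    components, and is cut at a vertex [z] of the infinite component, where both
    extended trails end.  In this case [f] itself may remain unchanged, but the
    two ends coincide. *)
Lemma extend2_left f g e0 : extensible2 f g -> Rm (f ++ g) e0 ->
  conn (Rm (f ++ g)) (dst v0 f) (src e0) ->
  exists q1 q2, [/\ extensible2 (f ++ q1) (g ++ q2), e0 \in q1 ++ q2 &
    q1 != [::] \/ dst v0 (f ++ q1) = dst v0 (g ++ q2)].
Proof.
move=> [[wf wg] ufg [lb la] cab] Re0 be0.
set b := dst v0 f in lb cab be0 *; set a := dst v0 g in la cab *.
set S := f ++ g in ufg lb la cab Re0 be0.
have eS : all ed S by rewrite all_cat (walk_all wf) (walk_all wg).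
have [p [wp up e0p]] := trail_through Re0 be0.
pose T := p ++ S.
have uT : uniq T.
  rewrite cat_uniq up ufg andbT; apply/hasPn => e ef; apply/negP =>
    /(walk_in wp).
  by rewrite /avoiding ef andbF.
have eT : all ed T by rewrite all_cat eS (walk_all (walk_avoiding wp)).
have [F finF] : exists F, finite_part src tgt ed T F.
  by apply: (finite_part_ex edge_conn (e0 := e0));
    rewrite ?mem_cat ?e0p ?(andP Re0).1.
set b' := dst b p.
have oT w : odd (dg T w) = (a == w) (+) (b' == w).
  rewrite deg_in_cat oddD odd_deg_two // (odd_deg_walk _ wp) -/a -/b -/b'.
  by case: (b == w); case: (b' == w); case: (a == w).
(* by parity, a finite component with one of [a] and [b'] contains the other *)
have fin_other x y : ~ infc (Rm T) x ->
    (forall w, odd (dg T w) = (x == w) (+) (y == w)) -> conn (Rm T) x y.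
  move=> fx Hxy; apply: contrapT => nxy; apply: (component_handshake parity uT
    eT fx).
  move=> w xw; rewrite Hxy addFb eq_sym; case: (eqVneq y w) => [eyw|_].
    by case: nxy; rewrite eyw.
  by rewrite addbF.
have oF w : odd (dg F w) = ~~ `[< infc (Rm T) w >] && ((a == w) (+) (b' == w)).
  by rewrite (odd_deg_finite_part parity finF w uT eT) oT.
have RF e : e \in F -> Rm S e /\ e \notin p.
  by move=> eF; have [/(_ eF)] := finF.2 e; rewrite avoiding_cat => -[/andP[]].
have T'E r : perm_eq r (p ++ F) ->
    forall f' g', f' ++ g' =i S ++ r ->
    forall e, (e \in f' ++ g') = (e \in T) || (e \in F).
  move=> pr f' g' fg e; rewrite fg !mem_cat (perm_mem pr) mem_cat.
  by case: (e \in p); case: (e \in f); case: (e \in g); case: (e \in F).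
have uS r : perm_eq r (p ++ F) -> uniq (S ++ r).
  move=> pr; rewrite cat_uniq ufg (perm_uniq pr) cat_uniq up finF.1 andbT /=.
  apply/andP; split; last by apply/hasPn => e /RF[].
  apply/hasPn => e; rewrite (perm_mem pr) mem_cat; apply: contraTN => eS'.
  apply/norP; split; apply/negP; [move/(walk_in wp)|case/RF];
    by rewrite /avoiding eS' andbF.
(* every component of [Rm T] meets [p] or contains [a] *)
have reach x : live (Rm S) x -> conn (Rm T) a x \/
    exists2 z, visits b p z & conn (Rm T) z x.
  case/cab => /(linked_or_visited wp)[]; [|by right|by left|by right].
  by right; exists b => //; apply: visits_start.
have [ia|fa] := pselect (infc (Rm T) a).
- have ib' : infc (Rm T) b'.
    apply: contrapT => fb'; apply: (fb'); apply: (infinite_at_linked ia);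
      apply: linked_sym.
    by apply: fin_other => // w; rewrite oT addbC.
  have [w|e eF|r [wr dr pr]] := absorb_finite_part (y := b') wp up finF.
  + rewrite oF addbb; case: asboolP => //= fw.
    case: eqP => [eaw|_]; first by case: fw; rewrite -eaw.
    by case: eqP => // ebw; case: fw; rewrite -ebw.
  + have [h|//] := reach _ (nonisolated_src (RF e eF).1).
    have [/(_ eF)[_ []]] := finF.2 e; exact: infinite_at_linked ia h.
  have memr : forall e, (e \in (f ++ r) ++ g) = (e \in T) || (e \in F).
    by apply: T'E pr _ _ _ => e; rewrite !mem_cat -!orbA (orbC (e \in g)).
  exists r, [::]; rewrite !cats0; split; last first.
  + by left; case: (r) pr => // /perm_size; case: (p) e0p.
  + by rewrite (perm_mem pr) mem_cat e0p.
  set T' := (f ++ r) ++ g in memr *.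
  have db' : dst v0 (f ++ r) = b' by rewrite walk_end_cat.
  have wfr : walk ed v0 (f ++ r) by rewrite walk_cat wf (walk_avoiding wr).
  have uT' : uniq T'.
    have pT' : perm_eq T' (S ++ r) by rewrite /T' /S -!catA perm_cat2l
      perm_catC.
    by rewrite (perm_uniq pT') uS.
  have ia' := infinite_at_finite_part finF memr ia; have ib'' :=
    infinite_at_finite_part finF memr ib'.
  split=> //; rewrite -/T' ?db' -/a; first by split;
    apply: infinite_at_nonisolated.
  move=> x lx; have ix := infinite_at_finite_part finF memr
    (nonisolated_finite_part finF memr lx).
  apply: contrapT => /not_orP[nbx nax].
  case: (two_ends ia' ib'' ix) => // /linked_trail[s [ws us ds]].
  (* [s] completes the used edges to a finite set with even degrees; if the
     component of [x] missed both ends, [s] would not touch it, and removing [s]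
     would also leave an infinite part [y] of the component of [a] *)
  have [y ay iy] := infinite_at_removal s ia'.
  have ix' : infc (Rm (s ++ T')) x.
    move=> U; have [e [Re neU xe]] := ix U; exists e.
    have nax' z : conn (Rm T') x z -> ~ conn (Rm T') a z.
      by move=> xz az; apply: nax; apply: linked_trans az (linked_sym xz).
    have keep z e' : conn (Rm T') x z -> Rm T' e' -> inc e' z ->
      Rm (s ++ T') e'.
      move=> xz Re' ez; rewrite avoiding_cat Re'; apply/negP => es.
      have [z' vz' ez'] := walk_edge_visits ws es; apply: (nax' z') => //.
        by apply: linked_trans xz (linked_edge Re' ez ez').
      have [s1 [s2 [ds' dz]]] := visits_split vz'; exists s1 => //.
      by move: ws; rewrite ds' walk_cat => /andP[].
    split=> //; first by apply: keep xe Re (incident_src _ _ _).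
    have keep_walk q z : conn (Rm T') x z -> walk (Rm T') z q ->
        walk (Rm (s ++ T')) z q.
      elim: q z => //= e' q IHq z xz /and3P[Re' ez wq].
      rewrite ez (keep z) //=; apply: IHq => //.
      exact: linked_trans xz (linked_edge Re' ez (incident_opposite _ _ _ _)).
    by case: xe => q wq dq; exists q => //; apply: keep_walk => //;
      apply: linked_refl.
  have xy : conn (Rm (s ++ T')) x y.
    apply: even_one_end => //.
    + rewrite cat_uniq us uT' andbT; apply/hasPn => e eT'; apply/negP.
      by move/(walk_in ws); rewrite /avoiding eT' andbF.
    + by rewrite all_cat (walk_all (walk_avoiding ws)) all_cat (walk_all wfr)
        (walk_all wg).
    move=> w; rewrite deg_in_cat oddD odd_deg_two // (odd_deg_walk _ ws) ds db'
      -/a.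
    by case: (a == w); case: (b' == w).
  apply: nax; apply: linked_trans ay (linked_sym _).
  by apply: linked_sub xy => e; rewrite avoiding_cat => /andP[].
have ab' : conn (Rm T) a b' by apply: fin_other.
have fb' : ~ infc (Rm T) b' by move=> /infinite_at_linked/(_ (linked_sym ab')).
have touch' x : live (Rm S) x -> exists2 z, visits b p z & conn (Rm T) z x.
  case/reach => [ax|//]; exists b'; first exact: visits_end.
  exact: linked_trans (linked_sym ab') ax.
have [w|e eF|r [wr dr pr]] := absorb_finite_part (y := a) wp up finF.
- rewrite oF -/b' addbC; case: asboolP => //= iw.
  case: eqP => [eaw|_]; first by case: fb'; rewrite eaw.
  by case: eqP => // eaw; case: fa; rewrite eaw.
- exact: touch' (nonisolated_src (RF e eF).1).
(* an infinite component is left, and it meets [p] because [a] is not in it *)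
have [e1 ee1 ne1] := edge_inf (S ++ r).
have [z [vz iz]] : exists z, visits b p z /\ infc (Rm T) z.
  have [eS1 er1] : e1 \notin S /\ e1 \notin r.
    by apply/andP; move: ne1; rewrite mem_cat negb_or.
  have RS1 : Rm S e1 by rewrite /avoiding ee1.
  move: er1; rewrite (perm_mem pr) mem_cat negb_or => /andP[nep neF].
  have RT1 : Rm T e1 by rewrite avoiding_cat RS1.
  have [z vz ze] := touch' _ (nonisolated_src RS1); exists z; split=> //.
  apply: contrapT => fz; case/negP: neF; apply/finF.2; split=> // ie.
  by apply: fz; apply: infinite_at_linked ie (linked_sym ze).
have [r1 [r2 [def_r dz]]] : exists r1 r2, r = r1 ++ r2 /\ dst b r1 = z.
  apply: visits_split; have [->|[e ep ez]] := visits_cases wp vz.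
    exact: visits_start.
  by apply: (visits_incident wr _ ez); rewrite (perm_mem pr) mem_cat ep.
have [wr1 wr2] : walk (Rm S) b r1 /\ walk (Rm S) z r2.
  by apply/andP; move: wr; rewrite def_r walk_cat dz.
have dr2 : dst z r2 = a by rewrite -dz -walk_end_cat -def_r.
have [] := walk_rev wr2; rewrite dr2 => wr2' dr2'.
have memr : forall e, (e \in (f ++ r1) ++ (g ++ rev r2)) = (e \in T) || (e \in
  F).
  apply: T'E pr _ _ _ => e; rewrite def_r !mem_cat mem_rev.
  by case: (e \in f); case: (e \in r1); case: (e \in g); case: (e \in r2).
exists r1, (rev r2); split; last first.
- by right; rewrite !walk_end_cat -/a -/b dz dr2'.
- have: e0 \in r by rewrite (perm_mem pr) mem_cat e0p.
  by rewrite def_r !mem_cat mem_rev.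
have iz' := infinite_at_finite_part finF memr iz.
have wfr1 : walk ed v0 (f ++ r1) by rewrite walk_cat wf (walk_avoiding wr1).
have wgr2 : walk ed v0 (g ++ rev r2) by rewrite walk_cat wg (walk_avoiding
  wr2').
set T' := (_ ++ _) ++ _ in memr iz' *.
have uT' : uniq T'.
  have pT' : perm_eq T' (S ++ r).
    rewrite /T' /S def_r -!catA perm_cat2l perm_catCA perm_cat2l.
    by rewrite perm_cat2l perm_rev.
  by rewrite (perm_uniq pT') uS.
have df : dst v0 (f ++ r1) = z by rewrite walk_end_cat.
have dg' : dst v0 (g ++ rev r2) = z by rewrite walk_end_cat.
split=> //; rewrite -/T' df dg'; first by split; apply: infinite_at_nonisolated.
move=> x lx; left; apply: even_one_end => //.
- by rewrite all_cat (walk_all wfr1) (walk_all wgr2).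
- by move=> w; rewrite odd_deg_two // df dg' addbb.
exact: (infinite_at_finite_part finF memr (nonisolated_finite_part finF memr
  lx)).
Qed.

Lemma extend2 f g e0 : extensible2 f g -> Rm (f ++ g) e0 ->
  exists q1 q2, extensible2 (f ++ q1) (g ++ q2) /\ e0 \in q1 ++ q2.
Proof.
move=> gfg Re0; have [_ _ _ /(_ _ (nonisolated_src Re0))[be|ae]] := gfg.
  by have [q1 [q2 [? ? _]]] := extend2_left gfg Re0 be; exists q1, q2.
have [||q2 [q1 [gq e0q _]]] := extend2_left (e0 := e0) (extensible2C gfg).
- by rewrite -(eq_avoiding (T := f ++ g)) // => e; rewrite !mem_cat orbC.
- by apply: linked_sub ae => e; rewrite (eq_avoiding (T' := g ++ f)) // => x;
    rewrite !mem_cat orbC.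
exists q1, q2; split; first exact: extensible2C.
by rewrite mem_cat orbC -mem_cat.
Qed.

(** Two ends at the same vertex may be exchanged. *)
Lemma extensible2_swap f g r : extensible2 f (g ++ r) -> dst v0 f = dst v0 g ->
  extensible2 (f ++ r) g.
Proof.
rewrite /extensible2 => + dfg; rewrite !walk_end_cat dfg.
have -> : Rm ((f ++ r) ++ g) = Rm (f ++ g ++ r).
  by apply/funext/eq_avoiding => e; rewrite !mem_cat orbAC orbA.
move=> [[wf wgr] u [lf lg] c]; split=> //; last by move=> x /c[]; [right|left].
  by move: wgr; rewrite !walk_cat wf dfg => /andP[].
rewrite (perm_uniq (_ : perm_eq _ (f ++ g ++ r))) //.
by rewrite -catA perm_cat2l perm_catC.
Qed.

(** If an extension leaves [f] unchanged, the two ends coincide, and the next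
    extension can be given to either trail. *)
Lemma progress2_left f g : extensible2 f g ->
  exists q1 q2, extensible2 (f ++ q1) (g ++ q2) /\ q1 != [::].
Proof.
move=> gfg; have [_ _ [[e Re eb] _] _] := gfg.
have [q1 [q2 [gq _ eq12]]] := extend2_left gfg Re (linked_src Re eb).
have [q0|] := eqVneq q1 [::]; last by exists q1, q2.
rewrite {}q0 in gq eq12; case: eq12 => // dfg; have [_ _ [[e' Re' _] _] _] :=
  gq.
have [r1 [r2 [gr e'r]]] := extend2 gq Re'; case: r1 gr e'r => [|e1 r1] gr e'r.
  exists r2, q2; split; last by case: (r2) e'r.
  by rewrite !cats0 in gr dfg *; apply: extensible2_swap.
by exists (e1 :: r1), (q2 ++ r2); rewrite catA; rewrite cats0 in gr.
Qed.

Lemma progress2 f g e0 : extensible2 f g -> ed e0 -> exists q1 q2,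
  [/\ extensible2 (f ++ q1) (g ++ q2), e0 \in (f ++ q1) ++ (g ++ q2),
      q1 != [::] & q2 != [::]].
Proof.
move=> gfg ee0.
have [p1 [p2 [gp e0p]]] : exists p1 p2, extensible2 (f ++ p1) (g ++ p2) /\
    e0 \in (f ++ p1) ++ (g ++ p2).
  have [e0fg|ne0] := boolP (e0 \in f ++ g).
    by exists [::], [::]; rewrite !cats0.
  have [|p1 [p2 [gp e0p]]] := extend2 (e0 := e0) gfg.
    by rewrite /avoiding ee0.
  exists p1, p2; split=> //; move: e0p; rewrite !mem_cat.
  by case/orP=> ->; rewrite ?orbT.
have [q1 [q2 [gq q10]]] := progress2_left gp.
have [r2 [r1 [/extensible2C gr r20]]] := progress2_left (extensible2C gq).
exists (p1 ++ q1 ++ r1), (p2 ++ q2 ++ r2); rewrite !catA; split=> //.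
- by move: e0p; rewrite !mem_cat => /orP[]/orP[]->; rewrite ?orbT.
- by case: (p1) (q1) q10 => [|? ?] [].
by case: (p2) (q2) (r2) r20 => [|? ?] [|? ?] [].
Qed.

End TwoWay.
End Trails.

(** * Closure properties of computable functions *)

Lemma computable_comp m k (g : m.-tuple nat -> nat)
    (h : 'I_m -> k.-tuple nat -> nat) :
  computable g -> (forall i, computable (h i)) ->
  computable (fun x => g [tuple h i x | i < m]).
Proof.
move=> [cg Hg] /choice[ch Hh]; exists (Comp cg ch) => x.
by apply: eval_Comp (Hg _) => i; rewrite tnth_mktuple; apply: Hh.
Qed.

Lemma computable_ext k (f g : k.-tuple nat -> nat) :
  f =1 g -> computable f -> computable g.
Proof. by move=> fg [c Hc]; exists c => x; rewrite -fg; apply: Hc. Qed.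

Lemma computable_proj k (i : 'I_k) : computable (fun x => tnth x i).
Proof. by exists (Proj i) => x; apply: eval_Proj. Qed.

Lemma computable_app k (f : nat -> nat) (h : k.-tuple nat -> nat) :
  computable_nat f -> computable h -> computable (fun x => f (h x)).
Proof.
move=> cf ch.
apply: computable_ext (computable_comp (h := fun=> h) cf (fun=> ch)) => x.
by rewrite /thead tnth_mktuple.
Qed.

Lemma computable_succ : computable_nat succn.
Proof. by exists Succ => x; apply: eval_Succ. Qed.

Lemma computable_const k n : computable (fun _ : k.-tuple nat => n).
Proof.
elim: n => [|n IHn]; first by exists (Zero k) => x; apply: eval_Zero.
exact: (computable_app computable_succ IHn).
Qed.

Definition computable2 (f : nat -> nat -> nat) :=
  computable (fun x : 2.-tuple nat => f (tnth x ord0) (tnth x (lift ord0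
    ord0))).

Definition computable3 (f : nat -> nat -> nat -> nat) :=
  computable (fun x : 3.-tuple nat =>
    f (tnth x ord0) (tnth x (lift ord0 ord0)) (tnth x (lift ord0 (lift ord0
      ord0)))).

Lemma computable_app2 k f (g h : k.-tuple nat -> nat) :
  computable2 f -> computable g -> computable h ->
  computable (fun x => f (g x) (h x)).
Proof.
move=> cf cg ch; pose a (i : 'I_2) := if val i is 0 then g else h.
have ca i : computable (a i) by case: i => -[].
by apply: computable_ext (computable_comp cf ca) => x; rewrite !tnth_mktuple.
Qed.

Lemma computable_app3 k f (g h l : k.-tuple nat -> nat) :
  computable3 f -> computable g -> computable h -> computable l ->
  computable (fun x => f (g x) (h x) (l x)).
Proof.
move=> cf cg ch cl.
pose a (i : 'I_3) := match val i with 0 => g | 1 => h | _ => l end.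
have ca i : computable (a i) by case: i => -[|[]].
by apply: computable_ext (computable_comp cf ca) => x; rewrite !tnth_mktuple.
Qed.

Lemma computable_nat_app2 (f : nat -> nat -> nat) (g h : nat -> nat) :
  computable2 f -> computable_nat g -> computable_nat h ->
  computable_nat (fun n => f (g n) (h n)).
Proof. exact: computable_app2. Qed.

Lemma computable_nat_comp (f g : nat -> nat) :
  computable_nat f -> computable_nat g -> computable_nat (fun n => f (g n)).
Proof. exact: computable_app. Qed.

Lemma computable_nat_const n : computable_nat (fun=> n).
Proof. exact: computable_const. Qed.

Lemma computable_nat_id : computable_nat id.
Proof. exact: computable_proj. Qed.

Lemma computable2_rec (f : nat -> nat) (g : nat -> nat -> nat -> nat) :
  computable_nat f -> computable3 g ->
  computable2 (fun n a => nat_rect (fun=> nat) (f a) (fun i r => g i r a) n).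
Proof.
move=> [cf Hf] [cg Hg]; exists (Prec cf cg) => -[[|n [|a []]]] // sx.
have -> : Tuple sx = [tuple of n :: [tuple a]] by apply: val_inj.
rewrite !(tnth_nth 0) /=; elim: n {sx} => [|n IHn] /=.
  by apply: eval_Prec0; apply: (Hf [tuple a]).
apply: (eval_PrecS IHn); set r := nat_rect _ _ _ _.
by have := Hg [tuple n; r; a]; rewrite !(tnth_nth 0).
Qed.

Lemma computable_nat_rec n0 (g : nat -> nat -> nat) : computable2 g ->
  computable_nat (fun n => nat_rect (fun=> nat) n0 g n).
Proof.
move=> cg; pose g' i r (a : nat) := g i r.
have cg' : computable3 g' by apply: computable_app2 cg _ _;
  apply: computable_proj.
have c2 := computable2_rec (computable_const 1 n0) cg'.
exact: (computable_nat_app2 c2 computable_nat_id computable_nat_id).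
Qed.

Lemma computable_nat_mu (P : nat -> nat -> nat) (m : nat -> nat) :
  computable2 P -> (forall x, P x (m x) = 0) ->
  (forall x z, z < m x -> 0 < P x z) -> computable_nat m.
Proof.
move=> cP Pm Pz; pose Q z x := P x z.
have [cQ HQ] : computable2 Q.
  by apply: computable_app2 cP _ _; apply: computable_proj.
exists (Mu cQ) => x; apply: eval_Mu => [z zm|].
  exists (P (thead x) z).-1; rewrite prednK ?Pz //.
  by have := HQ [tuple of z :: x]; rewrite /Q !(tnth_nth 0) /= -(tnth_nth 0 x
    ord0).
by have := HQ [tuple of m (thead x) :: x]; rewrite /Q !(tnth_nth 0) /=
  -(tnth_nth 0 x ord0) Pm.
Qed.

(** The values of [S] are found one after the other by unbounded search.  The
    search for a successor of [r] may diverge if [r] is not a value of [S]: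
    recursion only evaluates it along the sequence. *)
Lemma computable_search (P : nat -> nat -> nat -> nat) (S : nat -> nat) :
  computable3 P ->
  (forall n, P n (S n) (S n.+1) = 0) ->
  (forall n z, z < S n.+1 -> 0 < P n (S n) z) -> computable_nat S.
Proof.
move=> cP Pm Pz; pose Q z n r := P n r z.
have [cQ HQ] : computable3 Q.
  by apply: computable_app3 cP _ _ _; apply: computable_proj.
have [c0 H0] := computable_const 0 (S 0).
exists (Prec c0 (Mu cQ)) => -[[|n []]] // sx.
have -> : Tuple sx = [tuple of n :: [tuple]] by apply: val_inj.
rewrite /thead (tnth_nth 0) /=; elim: n {sx} => [|n IHn] /=.
  by apply: eval_Prec0; apply: H0.
apply: (eval_PrecS IHn); apply: eval_Mu => [z zm|].
  by exists (P n (S n) z).-1; rewrite prednK ?Pz //; apply: (HQ [tuple z; n;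
    S n]).
by have := HQ [tuple S n.+1; n; S n]; rewrite /Q !(tnth_nth 0) /= Pm.
Qed.

Lemma computable_nat_ext (f g : nat -> nat) : f =1 g -> computable_nat f ->
  computable_nat g.
Proof. by move=> /funext->. Qed.

Lemma computable2_add : computable2 addn.
Proof.
have cg : computable3 (fun _ r _ => r.+1).
  exact: computable_app computable_succ (computable_proj _).
apply: computable_ext (computable2_rec computable_nat_id cg) => x.
by elim: (tnth x ord0) => //= n ->.
Qed.

Lemma computable_pred : computable_nat predn.
Proof.
have cg : computable2 (fun i _ => i) by apply: computable_proj.
by apply: computable_nat_ext (computable_nat_rec 0 cg) => -[].
Qed.

Lemma computable2_sub : computable2 subn.
Proof.
have cg : computable3 (fun _ r _ => r.-1).
  exact: computable_app computable_pred (computable_proj _).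
have c2 := computable2_rec computable_nat_id cg.
apply: computable_ext (computable_app2 c2
  (computable_proj (lift ord0 ord0)) (computable_proj (ord0 : 'I_2))) => x /=.
by elim: (tnth x (lift ord0 ord0)) => [|n /= ->]; rewrite ?subn0 ?subnS.
Qed.

(** * Cantor pairing *)

Definition tri n := nat_rect (fun=> nat) 0 (fun i r => r + i.+1) n.

Lemma triS n : tri n.+1 = tri n + n.+1. Proof. by []. Qed.

Lemma leq_tri m n : m <= n -> tri m <= tri n.
Proof.
elim: n => [|n IHn]; first by rewrite leqn0 => /eqP->.
rewrite leq_eqVlt ltnS => /orP[/eqP->//|/IHn].
by rewrite triS; lia.
Qed.

Lemma leq_id_tri n : n <= tri n.
Proof. by elim: n => // n IHn; rewrite triS; lia. Qed.

Lemma computable_tri : computable_nat tri.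
Proof.
apply: computable_nat_rec.
apply: computable_app2 computable2_add (computable_proj _) _.
exact: computable_app computable_succ (computable_proj _).
Qed.

Lemma diag_ex n : exists s, n < tri s.+1.
Proof. by exists n; rewrite triS; have := leq_id_tri n; lia. Qed.

(** The Cantor enumeration of pairs of natural numbers, one antidiagonal after
    the other; [diag n] is the antidiagonal on which the [n]-th pair lies. *)
Definition cpair x y := tri (x + y) + x.

Definition diag n := ex_minn (diag_ex n).

Definition cfst n := n - tri (diag n).

Definition csnd n := diag n - cfst n.

Lemma diagP n : tri (diag n) <= n < tri (diag n).+1.
Proof.
rewrite /diag; case: ex_minnP => -[|s] -> Hmin //; rewrite andbT leqNgt.
by apply/negP => /Hmin; rewrite ltnn.
Qed.

Lemma diag_eq n s : tri s <= n < tri s.+1 -> diag n = s.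
Proof.
move=> /andP[H1 H2]; have /andP[H3 H4] := diagP n.
by case: (ltngtP (diag n) s) => // /leq_tri; lia.
Qed.

Lemma diag_cpair x y : diag (cpair x y) = x + y.
Proof. by apply: diag_eq; rewrite /cpair triS; lia. Qed.

Lemma cpairK1 x y : cfst (cpair x y) = x.
Proof. by rewrite /cfst diag_cpair addKn. Qed.

Lemma cpairK2 x y : csnd (cpair x y) = y.
Proof. by rewrite /csnd cpairK1 diag_cpair addKn. Qed.

Lemma cunpairK n : cpair (cfst n) (csnd n) = n.
Proof.
have /andP[H1 H2] := diagP n; rewrite triS in H2.
by rewrite /cpair /csnd /cfst subnKC ?subnKC //; lia.
Qed.

Lemma leq_cpair x y : x <= cpair x y /\ y <= cpair x y.
Proof. by rewrite /cpair; have := leq_id_tri (x + y); lia. Qed.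

Lemma computable2_pair : computable2 cpair.
Proof.
apply: computable_app2 computable2_add _ (computable_proj _).
apply: computable_app computable_tri _.
exact: computable_app2 computable2_add (computable_proj _) (computable_proj _).
Qed.

Lemma computable_diag : computable_nat diag.
Proof.
apply: (@computable_nat_mu (fun n s => n.+1 - tri s.+1)).
- apply: computable_app2 computable2_sub _ _.
    exact: computable_app computable_succ (computable_proj _).
  apply: computable_app computable_tri _.
  exact: computable_app computable_succ (computable_proj _).
- by move=> n; have /andP[_] := diagP n; rewrite triS; lia.
move=> n s sd; have /andP[H _] := diagP n.
have /leq_tri: s.+1 <= diag n by [].
by lia.
Qed.

Lemma computable_cfst : computable_nat cfst.
Proof.
apply: computable_nat_app2 computable2_sub computable_nat_id _.
exact: computable_nat_comp computable_tri computable_diag.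
Qed.

Lemma computable_csnd : computable_nat csnd.
Proof.
exact: computable_nat_app2 computable2_sub computable_diag computable_cfst.
Qed.

(** * Computability over encoded data *)

(** The encoding is bijective, so that a search through all numbers is a search
    through all elements. *)
Record codeType := CodeType {
  csort :> Type;
  enc : csort -> nat;
  dec : nat -> csort;
  encK : cancel enc dec;
  decK : cancel dec enc
}.
Arguments enc {_}.
Arguments dec {_}.

Lemma id_encK (n : nat) : id (id n) = n. Proof. by []. Qed.
Canonical nat_code := @CodeType nat id id id_encK id_encK.

Section PairCode.
Variables A B : codeType.
Definition pair_enc (p : A * B) := cpair (enc p.1) (enc p.2).
Definition pair_dec n : A * B := (dec (cfst n), dec (csnd n)).
Lemma pair_encK : cancel pair_enc pair_dec.
Proof. by move=> [a b]; rewrite /pair_dec /pair_enc cpairK1 cpairK2 !encK. Qed.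
Lemma pair_decK : cancel pair_dec pair_enc.
Proof. by move=> n; rewrite /pair_dec /pair_enc !decK cunpairK. Qed.
Canonical pair_code := CodeType pair_encK pair_decK.
End PairCode.

Section SeqCode.
Variable A : codeType.
Definition seq_enc := foldr (fun (x : A) n => (cpair (enc x) n).+1) 0.
(* the fuel [k] is enough as soon as [n <= k], since [csnd n' <= n'] *)
Fixpoint seq_dec_rec k n : seq A :=
  if k is k'.+1 then
    if n is n'.+1 then dec (cfst n') :: seq_dec_rec k' (csnd n') else [::]
  else [::].
Definition seq_dec n := seq_dec_rec n n.
Lemma seq_dec_recK s k : size s <= k -> seq_dec_rec k (seq_enc s) = s.
Proof.
elim: s k => [|x s IHs] [|k] //= sk.
by rewrite cpairK1 cpairK2 encK IHs.
Qed.
Lemma size_seq_enc s : size s <= seq_enc s.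
Proof.
elim: s => //= x s IHs; have [_] := leq_cpair (enc x) (seq_enc s).
by rewrite ltnS; apply: leq_trans.
Qed.
Lemma seq_encK : cancel seq_enc seq_dec.
Proof. by move=> s; apply: seq_dec_recK; apply: size_seq_enc. Qed.
Lemma seq_decK : cancel seq_dec seq_enc.
Proof.
move=> n; rewrite /seq_dec; suff: forall k, n <= k ->
  seq_enc (seq_dec_rec k n) = n.
  exact.
elim/ltn_ind: n => -[|n] IHn [|k] //= nk; rewrite decK.
have csn : csnd n <= n by have [_] := leq_cpair (cfst n) (csnd n);
  rewrite cunpairK.
by rewrite IHn ?cunpairK // (leq_trans csn).
Qed.
Canonical seq_code := CodeType seq_encK seq_decK.
End SeqCode.

(** Computability of functions between encoded types.  The closure lemmas below
    are stated in a context [a : A], with the variables of binders packed into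
    pairs, so that they can be applied under binders. *)
Definition effective (A B : codeType) (f : A -> B) :=
  computable_nat (fun n => enc (f (dec n))).

Definition effectiveb (A : codeType) (f : A -> bool) := effective (fun a =>
  f a : nat).

Section Effective.
Variables A B C D : codeType.
Implicit Types (a : A) (b : B) (c : C) (d : D).

Lemma eff_comp (g : B -> C) (f : A -> B) :
  effective g -> effective f -> effective (fun a => g (f a)).
Proof.
rewrite /effective => cg cf; have := computable_nat_comp cg cf.
by apply: computable_nat_ext => n; rewrite encK.
Qed.

Lemma eff_id : effective (fun a => a).
Proof. by apply: computable_nat_ext computable_nat_id => n; rewrite decK. Qed.

Lemma eff_const b : effective (fun a => b).
Proof. exact: computable_nat_const. Qed.

Lemma eff_pair (f : A -> B) (g : A -> C) :
  effective f -> effective g -> effective (fun a => (f a, g a)).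
Proof. exact: computable_nat_app2 computable2_pair. Qed.

Lemma eff_fst (f : A -> B * C) : effective f -> effective (fun a => (f a).1).
Proof.
rewrite /effective => cf; have := computable_nat_comp computable_cfst cf.
by apply: computable_nat_ext => n /=; rewrite /pair_enc cpairK1.
Qed.

Lemma eff_snd (f : A -> B * C) : effective f -> effective (fun a => (f a).2).
Proof.
rewrite /effective => cf; have := computable_nat_comp computable_csnd cf.
by apply: computable_nat_ext => n /=; rewrite /pair_enc cpairK2.
Qed.

Lemma eff_nat1 (F : nat -> nat) (f : A -> nat) :
  computable_nat F -> effective f -> effective (fun a => F (f a)).
Proof. exact: computable_nat_comp. Qed.

Lemma eff_nat2 (F : nat -> nat -> nat) (f g : A -> nat) :
  computable2 F -> effective f -> effective g -> effective (fun a =>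
    F (f a) (g a)).
Proof. exact: computable_nat_app2. Qed.

Lemma eff_nat3 (F : nat -> nat -> nat -> nat) (f g h : A -> nat) :
  computable3 F -> effective f -> effective g -> effective h ->
  effective (fun a => F (f a) (g a) (h a)).
Proof. exact: computable_app3. Qed.

Lemma eff_S (f : A -> nat) : effective f -> effective (fun a => (f a).+1).
Proof. exact: eff_nat1 computable_succ. Qed.

Lemma eff_rec (f : A -> B) (g : A -> nat -> B -> B) (n : A -> nat) :
  effective f -> effective (fun x : A * nat * B => g x.1.1 x.1.2 x.2) ->
    effective n ->
  effective (fun a => nat_rect (fun=> B) (f a) (g a) (n a)).
Proof.
rewrite /effective => cf cg cn; pose G i r m := enc (g (dec m) i (dec r)).
have cG : computable3 G.
  pose c r i m := cpair (cpair m i) r.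
  have cc : computable3 c.
    apply: computable_app2 computable2_pair _ (computable_proj _).
    exact: computable_app2 computable2_pair (computable_proj _) (computable_proj
      _).
  apply: computable_ext (computable_app cg (computable_app3 cc
    (computable_proj (lift ord0 ord0)) (computable_proj (ord0 : 'I_3))
    (computable_proj (lift ord0 (lift ord0 ord0))))) => x /=.
  by rewrite /c /pair_dec /= /pair_dec !(cpairK1, cpairK2).
have c2 := computable2_rec cf cG.
have := computable_nat_app2 c2 cn computable_nat_id.
apply: computable_nat_ext => m /=; elim: (n (dec m)) => //= i ->.
by rewrite /G encK.
Qed.

End Effective.

Section EffectiveData.
Variables A B C X : codeType.

Lemma eff_iter (f : A -> B) (g : A -> B -> B) (n : A -> nat) :
  effective f -> effective (fun x : A * B => g x.1 x.2) -> effective n ->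
  effective (fun a => iter (n a) (g a) (f a)).
Proof.
move=> cf cg cn; pose h (x : A * nat * B) := (x.1.1, x.2).
have ch : effective h.
  apply: eff_pair; last exact: eff_snd (eff_id _).
  exact: eff_fst (eff_fst (eff_id _)).
have := @eff_rec _ _ f (fun a _ => g a) n cf (eff_comp cg ch) cn.
by congr effective; apply/funext => a; elim: (n a) => //= m ->.
Qed.

Lemma eff_if (b : A -> bool) (f g : A -> B) :
  effectiveb b -> effective f -> effective g -> effective (fun a =>
    if b a then f a else g a).
Proof.
move=> cb cf cg.
have := @eff_rec _ _ g (fun a _ _ => f a) (fun a => b a : nat) cg _ cb.
have cf' : effective (fun x : A * nat * B => f x.1.1).
  exact: (eff_comp cf (eff_fst (eff_fst (eff_id _)))).
by move=> /(_ cf'); congr effective; apply/funext => a; case: (b a).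
Qed.

Lemma eff_cons (f : A -> X) (g : A -> seq X) :
  effective f -> effective g -> effective (fun a => f a :: g a).
Proof.
move=> cf cg; exact: computable_nat_comp computable_succ
  (computable_nat_app2 computable2_pair cf cg).
Qed.

Lemma eff_case_seq (f : A -> seq X) (g : A -> B) (h : A -> X -> seq X -> B) :
  effective f -> effective g -> effective (fun x : A * X * seq X =>
    h x.1.1 x.1.2 x.2) ->
  effective (fun a => if f a is x :: s then h a x s else g a).
Proof.
move=> cf cg ch.
pose k a m := h a (dec (cfst m)) (dec (csnd m)).
have ck : effective (fun x : A * nat * B => k x.1.1 x.1.2).
  pose j (x : A * nat * B) : A * X * seq X :=
    (x.1.1, dec (cfst x.1.2), dec (csnd x.1.2)).
  apply: (eff_comp ch (f := j)); apply: eff_pair.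
    apply: eff_pair; first exact: eff_fst (eff_fst (eff_id _)).
    have := eff_nat1 computable_cfst (eff_snd (eff_fst (eff_id (pair_code
      (pair_code A nat_code) B)))).
    by apply: computable_nat_ext => m /=; rewrite decK.
  have := eff_nat1 computable_csnd (eff_snd (eff_fst (eff_id (pair_code
    (pair_code A nat_code) B)))).
  by apply: computable_nat_ext => m /=; rewrite decK.
have cn : effective (fun a => enc (f a) : nat) by exact: cf.
have := @eff_rec _ _ g (fun a m _ => k a m) (fun a => enc (f a)) cg ck cn.
congr effective; apply/funext => a; case: (f a) => //= x s.
by rewrite /k cpairK1 cpairK2 encK (@encK (seq_code X)).
Qed.

End EffectiveData.

(** * Computable operations on sequences *)

Lemma eff_eq (A B : codeType) (f g : A -> B) : f =1 g -> effective f ->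
  effective g.
Proof. by move=> /funext->. Qed.

Section Lists.
Variables A B X : codeType.

(** The length of a sequence is at most its code, so that as many iterations as
    the code consume the whole sequence. *)
Lemma eff_foldl (f : A -> B) (g : A -> B -> X -> B) (l : A -> seq X) :
  effective f -> effective (fun x : A * B * X => g x.1.1 x.1.2 x.2) ->
    effective l ->
  effective (fun a => foldl (g a) (f a) (l a)).
Proof.
move=> cf cg cl.
pose step a (st : B * seq X) :=
  if st.2 is x :: s then (g a st.1 x, s) else (st.1, [::]).
have cstep : effective (fun x : A * (B * seq X) => step x.1 x.2).
  apply: (eff_case_seq (f := fun x : A * (B * seq X) => x.2.2)
    (h := fun x y s => (g x.1 x.2.1 y, s))).
  - exact: eff_snd (eff_snd (eff_id _)).
  - apply: eff_pair (eff_const _ _); exact: eff_fst (eff_snd (eff_id _)).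
  apply: eff_pair (eff_snd (eff_id _)).
  pose h (x : A * (B * seq X) * X * seq X) := (x.1.1.1, x.1.1.2.1, x.1.2).
  apply: (eff_comp cg (f := h)).
  apply: eff_pair; last exact: eff_snd (eff_fst (eff_id _)).
  apply: eff_pair; first exact: eff_fst (eff_fst (eff_fst (eff_id _))).
  exact: eff_fst (eff_snd (eff_fst (eff_fst (eff_id _)))).
have cn : effective (fun a => enc (l a) : nat) by exact: cl.
apply: eff_eq (eff_fst (eff_iter (g := step) (eff_pair cf cl) cstep cn)) => a.
have := size_seq_enc (l a); rewrite -[seq_enc _]/(enc _).
elim: (l a) (f a) (enc _) => [|x s IHs] r n /=.
  by have -> : iter n (step a) (r, [::]) = (r, [::]) by elim: n => //= n ->.
case: n => // n sn; rewrite iterSr /step /=; exact: IHs.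
Qed.

End Lists.

Section ListOps.
Variables A X : codeType.

Lemma eff_rev (l : A -> seq X) : effective l -> effective (fun a => rev (l a)).
Proof.
move=> cl; pose cons' (s : seq X) x := x :: s.
have c' : effective (fun x : A * seq X * X => cons' x.1.2 x.2).
  exact: eff_cons (eff_snd (eff_id _)) (eff_snd (eff_fst (eff_id _))).
apply: eff_eq (eff_foldl (g := fun=> cons') (eff_const A ([::] : seq X)) c' cl)
  => a.
by rewrite -[RHS]revK -[l a]revK foldl_rev !revK; elim: (rev _) => //= x s ->.
Qed.

Lemma eff_cat (l m : A -> seq X) :
  effective l -> effective m -> effective (fun a => l a ++ m a).
Proof.
move=> cl cm; pose cons' (s : seq X) x := x :: s.
have c' : effective (fun x : A * seq X * X => cons' x.1.2 x.2).
  exact: eff_cons (eff_snd (eff_id _)) (eff_snd (eff_fst (eff_id _))).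
apply: eff_eq (eff_foldl (g := fun=> cons') cm c' (eff_rev cl)) => a.
by rewrite foldl_rev; elim: (l a) => //= x s ->.
Qed.

Lemma eff_nth x0 (l : A -> seq X) (n : A -> nat) :
  effective l -> effective n -> effective (fun a => nth x0 (l a) (n a)).
Proof.
move=> cl cn.
have cb : effective (fun x : A * seq X => behead x.2).
  apply: eff_eq (eff_case_seq (h := fun _ _ s => s) (eff_snd (eff_id _))
    (eff_const _ [::]) (eff_snd (eff_id _))) => -[a []] //.
apply: eff_eq (eff_case_seq (h := fun _ x _ => x) (eff_iter (g :=
  fun=> behead) cl cb cn)
  (eff_const _ x0) (eff_snd (eff_fst (eff_id _)))) => a.
elim: (n a) (l a) => [|k IHk] l'; first by case: l'.
by rewrite iterSr IHk; case: l' => //=; case: k {IHk}.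
Qed.

Lemma effb_not (b : A -> bool) : effectiveb b -> effectiveb (fun a => ~~ b a).
Proof.
move=> cb; apply: eff_eq (eff_if cb (eff_const _ 0) (eff_const _ 1)) => a.
by case: (b a).
Qed.

Lemma effb_and (b c : A -> bool) :
  effectiveb b -> effectiveb c -> effectiveb (fun a => b a && c a).
Proof.
move=> cb cc; apply: eff_eq (eff_if cb cc (eff_const _ 0)) => a.
by case: (b a).
Qed.

Lemma effb_or (b c : A -> bool) :
  effectiveb b -> effectiveb c -> effectiveb (fun a => b a || c a).
Proof.
move=> cb cc; apply: eff_eq (eff_if cb (eff_const _ 1) cc) => a.
by case: (b a).
Qed.

Lemma effb_eq (f g : A -> X) : effective f -> effective g ->
  effectiveb (fun a => enc (f a) == enc (g a)).
Proof.
move=> cf cg; have cf' : effective (fun a => enc (f a) : nat) by [].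
have cg' : effective (fun a => enc (g a) : nat) by [].
apply: eff_eq (eff_nat2 computable2_sub (eff_const _ 1) (eff_nat2
  computable2_add
 (eff_nat2 computable2_sub cf' cg') (eff_nat2 computable2_sub cg' cf'))) =>
   a /=.
by case: eqP; lia.
Qed.

End ListOps.

Section Quantifiers.
Variables A X : codeType.

Lemma effb_all (P : A -> X -> bool) (l : A -> seq X) :
  effectiveb (fun x : A * X => P x.1 x.2) -> effective l ->
    effectiveb (fun a => all (P a) (l a)).
Proof.
move=> cP cl; pose st a (r : nat) x := if P a x then r else 0.
have cst : effective (fun x : A * nat * X => st x.1.1 x.1.2 x.2).
  apply: eff_if; [|exact: eff_snd (eff_fst (eff_id _))|exact: eff_const].
  pose h (x : A * nat * X) := (x.1.1, x.2).
  apply: (eff_comp cP (f := h)); apply: eff_pair;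
    last exact: eff_snd (eff_id _).
  exact: eff_fst (eff_fst (eff_id _)).
apply: eff_eq (eff_foldl (g := st) (eff_const A 1) cst cl) => a.
rewrite -{1}[1]/(nat_of_bool true) -[RHS]/(nat_of_bool (true && _)).
elim: (l a) true => [|x s IHs] b /=; first by rewrite andbT.
by rewrite /st; case: (P a x); rewrite ?andbF -?IHs //; apply: (IHs false).
Qed.

Lemma effb_has (P : A -> X -> bool) (l : A -> seq X) :
  effectiveb (fun x : A * X => P x.1 x.2) -> effective l ->
    effectiveb (fun a => has (P a) (l a)).
Proof.
move=> cP cl.
have := effb_not (effb_all (P := fun a x => ~~ P a x) (effb_not cP) cl).
by apply: eff_eq => a; rewrite -has_predC; congr nat_of_bool; apply: eq_has =>
  x; rewrite /= negbK.
Qed.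

End Quantifiers.

Lemma effb_eqn (A : codeType) (f g : A -> nat) : effective f -> effective g ->
  effectiveb (fun a => f a == g a).
Proof. exact: effb_eq. Qed.

Lemma effb_eqs (A : codeType) (f g : A -> seq nat) :
  effective f -> effective g -> effectiveb (fun a => f a == g a).
Proof.
move=> cf cg; apply: eff_eq (effb_eq cf cg) => a.
congr nat_of_bool; apply/eqP/eqP => [|-> //].
exact: (can_inj (@encK (seq_code nat_code))).
Qed.

Lemma effb_mem (A : codeType) (f : A -> nat) (l : A -> seq nat) :
  effective f -> effective l -> effectiveb (fun a => f a \in l a).
Proof.
move=> cf cl.
have cP : effectiveb (fun x : A * nat => f x.1 == x.2).
  apply: effb_eqn (eff_snd (eff_id _)); exact: eff_comp cf (eff_fst (eff_id _)).
apply: eff_eq (effb_has (P := fun a x => f a == x) cP cl) => a.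
by rewrite -has_pred1; congr nat_of_bool; apply: eq_has => x; rewrite /= eq_sym.
Qed.

Lemma eff_sum (A : codeType) (F : A -> nat -> nat) (l : A -> seq nat) :
  effective (fun x : A * nat => F x.1 x.2) -> effective l ->
  effective (fun a => \sum_(e <- l a) F a e).
Proof.
move=> cF cl; pose st a r e := r + F a e.
have cst : effective (fun x : A * nat * nat => st x.1.1 x.1.2 x.2).
  apply: eff_nat2 computable2_add _ _; first exact: eff_snd (eff_fst (eff_id
    _)).
  pose h (x : A * nat * nat) := (x.1.1, x.2).
  apply: (eff_comp cF (f := h)); apply: eff_pair;
    last exact: eff_snd (eff_id _).
  exact: eff_fst (eff_fst (eff_id _)).
apply: eff_eq (eff_foldl (g := st) (eff_const A 0) cst cl) => a.
have gen s r : foldl (st a) r s = r + \sum_(e <- s) F a e.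
  elim: s r => [|e s IHs] r /=; first by rewrite big_nil addn0.
  by rewrite IHs big_cons addnA.
by rewrite gen add0n.
Qed.

(** A sequence is duplicate-free iff it contains each of its items once. *)
Lemma effb_uniq (A : codeType) (l : A -> seq nat) : effective l ->
  effectiveb (fun a => uniq (l a)).
Proof.
move=> cl.
pose P a x := \sum_(y <- l a) (y == x : nat) == 1.
have cP : effectiveb (fun x : A * nat => P x.1 x.2).
  apply: effb_eqn (eff_const _ _).
  apply: (eff_sum (F := fun x y => y == x.2 : nat)).
    apply: effb_eqn (eff_snd (eff_id _)) (eff_snd (eff_fst (eff_id _))).
  exact: eff_comp cl (eff_fst (eff_id _)).
apply: eff_eq (effb_all cP cl) => a; congr nat_of_bool; rewrite /P.
have cE x : \sum_(y <- l a) (y == x : nat) = count_mem x (l a).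
  by rewrite -sum1_count [RHS]big_mkcond; apply: eq_bigr => y _ /=; case: eqP.
apply/allP/idP => [H|u x xl]; last by rewrite cE count_uniq_mem // xl.
apply: count_mem_uniq => x; have [xl|nx] := boolP (x \in l a).
  by have := H x xl; rewrite cE => /eqP.
exact/count_memPn.
Qed.

Ltac eff_tac := cbv beta; repeat first
  [ assumption
  | match goal with
    | |- effectiveb (fun _ => ~~ _) => apply: effb_not
    | |- effectiveb (fun _ => _ && _) => apply: effb_and
    | |- effectiveb (fun _ => _ || _) => apply: effb_or
    | |- effectiveb (fun _ => uniq _) => apply: effb_uniq
    | |- effectiveb (fun _ => all _ _) => apply: effb_all; cbv beta
    | |- effectiveb (fun _ => has _ _) => apply: effb_has; cbv beta
    | |- effectiveb (fun _ => _ \in _) => apply: effb_mem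
    | |- effectiveb (fun _ => @eq_op (seq _) _ _) => apply: effb_eqs
    | |- effectiveb (fun _ => @eq_op _ _ _) =>
      first [apply: effb_eqn | apply: effb_eqs]
    | |- effective (fun x => x) => apply: eff_id
    | |- effective (fun _ => (_, _)) => apply: eff_pair
    | |- effective fst => exact: eff_fst (eff_id _)
    | |- effective snd => exact: eff_snd (eff_id _)
    | |- effective (fun _ => fst _) => apply: eff_fst
    | |- effective (fun _ => snd _) => apply: eff_snd
    | |- effective (fun _ => _ + _) => apply: (eff_nat2 computable2_add)
    | |- effective (fun _ => S _) => apply: eff_S
    | |- effective (fun _ => _ ++ _) => apply: eff_cat
    | |- effective (fun _ => nat_of_bool _) => rewrite -/(effectiveb _)
    | |- effective (fun _ => if _ then _ else _) => apply: eff_if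
    | |- effective (fun _ => bigop _ _ _) => apply: eff_sum; cbv beta
    end
  | apply: eff_const ].

(** * Searching for trails *)

(** From a good state the search for a next state succeeds, and yields a good
    state again. *)
Lemma computable_run (Y : codeType) (P : nat -> Y -> Y -> bool)
    (good : Y -> Prop) (y0 : Y) :
  effectiveb (fun x : nat * Y * Y => P x.1.1 x.1.2 x.2) -> good y0 ->
  (forall n y, good y -> exists y', P n y y') ->
  (forall n y y', good y -> P n y y' -> good y') ->
  exists S : nat -> Y, [/\ effective S, S 0 = y0, forall n, good (S n) &
    forall n, P n (S n) (S n.+1)].
Proof.
move=> cP g0 ex keep.
pose F n c := if pselect (exists m, P n (dec c) (dec m)) is left h
  then ex_minn h else 0.
pose S := nat_rect (fun=> nat) (enc y0) F.
have FP n c : good (dec c) -> P n (dec c) (dec (F n c)) /\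
    forall m, m < F n c -> ~~ P n (dec c) (dec m).
  move=> /(ex n)[y' Py]; rewrite /F; case: pselect => [h|[]]; last first.
    by exists (enc y'); rewrite encK.
  case: ex_minnP => m Pm Hmin; split=> // k; apply: contraTN => /Hmin.
  by rewrite leqNgt.
have gS n : good (dec (S n)).
  elim: n => [|n IHn]; first by rewrite encK.
  by apply: keep IHn (FP n _ IHn).1.
exists (fun n => dec (S n)); split=> //; first 1 last.
- by rewrite /S /= encK.
- by move=> n; apply: (FP n _ (gS n)).1.
rewrite /effective; apply: (computable_nat_ext (f := S)) => [n|];
  first by rewrite decK.
pose Q n c c' := 1 - P n (dec c) (dec c').
apply: (@computable_search Q).
- apply: computable_app2 computable2_sub (computable_const _ 1) _.
  pose c3 n c c' := cpair (cpair n c) c'.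
  have cc3 : computable3 c3.
    apply: computable_app2 computable2_pair _ (computable_proj _).
    exact: computable_app2 computable2_pair (computable_proj _) (computable_proj
      _).
  have cP' : computable_nat (fun m =>
    P (cfst (cfst m)) (dec (csnd (cfst m))) (dec (csnd m)) : nat) := cP.
  apply: computable_ext (computable_app cP' cc3) => x /=.
  by rewrite /c3 !(cpairK1, cpairK2).
- by move=> n; rewrite /Q (FP n _ (gS n)).1.
by move=> n z zS; rewrite /Q (negbTE ((FP n _ (gS n)).2 z zS)).
Qed.

Section Algorithm.
Variables (isE : pred nat) (src tgt d : nat -> nat) (isV : pred nat) (v0 : nat).

Local Notation inc := (incident_to src tgt).
Local Notation other := (opposite src tgt).
Local Notation walk := (is_walk src tgt).
Local Notation dst := (walk_end src tgt).
Local Notation dg := (deg_in src tgt).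
Local Notation conn := (linked src tgt).
Local Notation live := (nonisolated src tgt).
Local Notation endpoints := (endpoints src tgt).
Local Notation Rm := (avoiding isE).

Hypothesis isE_effective : effectiveb isE.
Hypothesis src_effective : effective src.
Hypothesis tgt_effective : effective tgt.
Hypothesis d_computable : effective d.

(** [d] codes degrees, with [0] for infinity and [n.+1] for [n]; so [x] is dead
    when its degree is finite and all its edges are in [T]. *)
Definition dead (T : seq nat) (x : nat) := (d x != 0) && ((dg T x).+1 == d x).

Hypothesis edge_conn : forall x y, live isE x -> live isE y -> conn isE x y.
Hypothesis isV_v0 : isV v0.
Hypothesis isV_inc : forall e x, isE e -> inc e x -> isV x.
Hypothesis deadP : forall T x, uniq T -> all isE T -> isV x ->
  reflect (~ live (Rm T) x) (dead T x).

(** A decidable form of [anchored]: whether a vertex is connected to one of the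
    vertices [bs] is only semi-decidable, and the walks [ws] witness it. *)
Definition certified (T bs : seq nat) (ws : seq (seq nat)) :=
  all (fun b => ~~ dead T b) bs &&
  all (fun x => dead T x ||
    has (fun w => walk (Rm T) x w && (dst x w \in bs)) ws) (endpoints T).

Definition anchored (T bs : seq nat) :=
  (forall b, b \in bs -> live (Rm T) b) /\
  (forall x, live (Rm T) x -> exists2 b, b \in bs & conn (Rm T) b x).

Lemma isV_endpoints T x : all isE T -> x \in endpoints T -> isV x.
Proof.
move=> /allP eT; rewrite mem_cat => /orP[]/mapP[e /eT ee ->];
  by apply: isV_inc ee _; rewrite (incident_src, incident_tgt).
Qed.

(** It is enough to connect the endpoints of the edges in [T] to [bs], because
    in a connected graph a component left by the removal of [T] contains such an
    endpoint. *)
Lemma certified_sound T bs ws : uniq T -> all isE T -> T != [::] ->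
  all isV bs -> certified T bs ws -> anchored T bs.
Proof.
move=> uT eT T0 /allP Vbs /andP[/allP Lbs /allP Hws]; split.
  move=> b bbs; apply: contrapT => /(deadP uT eT (Vbs b bbs)).
  by rewrite (negbTE (Lbs b bbs)).
move=> x lx; have [e0 e0T] : exists e0, e0 \in T.
  by case: (T) T0 => // e s _; exists e; rewrite mem_head.
have ee0 := allP eT _ e0T.
have : conn isE x (src e0).
  apply: edge_conn; last by exists e0; rewrite ?incident_src.
  by case: lx => e /andP[ee _] ex; exists e.
have hit z : z \in endpoints T -> conn (Rm T) x z ->
    exists2 b, b \in bs & conn (Rm T) b x.
  move=> zT xz; have /orP[] := Hws z zT.
    move/(deadP uT eT (isV_endpoints eT zT)) => [];
      case: (linked_nonisolated xz) => // <-.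
    exact: lx.
  case/hasP=> w _ /andP[ww wbs]; exists (dst z w) => //.
  by apply: linked_sym; apply: linked_trans xz _; exists w.
case/(@first_hit _ _ _ _ _ (Rm T) (fun z => z \in endpoints T)) => [e ee||[z]].
- have [eTT|neT] := boolP (e \in T); last by left; rewrite /avoiding ee.
  by right=> z; apply: mem_endpoints eTT.
- by apply: hit; apply: mem_endpoints e0T (incident_src _ _ _).
exact: hit.
Qed.

Lemma certified_complete T bs : uniq T -> all isE T -> all isV bs ->
  anchored T bs -> exists ws, certified T bs ws.
Proof.
move=> uT eT /allP Vbs [lbs cbs].
have Hx x : exists w, x \in endpoints T -> dead T x || (walk (Rm T) x w &&
  (dst x w \in bs)).
  have [xT|] := boolP (x \in endpoints T); last by exists [::].
  have [dx|ndx] := boolP (dead T x); first by exists [::].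
  have lx : live (Rm T) x.
    by apply: contrapT => /(deadP uT eT (isV_endpoints eT xT));
      rewrite (negbTE ndx).
  by have [b bbs /linked_sym[w ww dw]] := cbs x lx; exists w; rewrite ww dw bbs.
have [w Hw] := choice Hx; exists (map w (endpoints T)); apply/andP; split.
  apply/allP => b bbs; apply/negP => /(deadP uT eT (Vbs b bbs)) []; exact: lbs.
apply/allP => x xT; have /orP[->//|ok] := Hw x xT; apply/orP; right.
by apply/hasP; exists (w x) => //; apply: map_f.
Qed.

Lemma isV_walk_end p : walk isE v0 p -> isV (dst v0 p).
Proof.
case/lastP: p => [//|p e]; rewrite -cats1 walk_cat walk_end_cat /= =>
  /and4P[_ ee _ _].
by apply: isV_inc ee _; apply: incident_opposite.
Qed.

Section EffectiveGraph.
Variable A : codeType.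

Lemma eff_src (e : A -> nat) : effective e -> effective (fun a => src (e a)).
Proof. exact: eff_nat1 src_effective. Qed.

Lemma eff_tgt (e : A -> nat) : effective e -> effective (fun a => tgt (e a)).
Proof. exact: eff_nat1 tgt_effective. Qed.

Lemma eff_d (e : A -> nat) : effective e -> effective (fun a => d (e a)).
Proof. exact: eff_nat1 d_computable. Qed.

Lemma effb_isE (e : A -> nat) : effective e -> effectiveb (fun a => isE (e a)).
Proof. exact: (eff_nat1 (F := isE)). Qed.

End EffectiveGraph.

Ltac eff_graph_tac := repeat first
  [ progress eff_tac
  | match goal with
    | |- effective (fun _ => src _) => apply: eff_src
    | |- effective (fun _ => tgt _) => apply: eff_tgt
    | |- effective (fun _ => d _) => apply: eff_d
    | |- effectiveb (fun _ => isE _) => apply: effb_isE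
    end ].

Lemma eff_other (A : codeType) (e x : A -> nat) :
  effective e -> effective x -> effective (fun a => other (e a) (x a)).
Proof. by move=> ce cx; rewrite /opposite; eff_graph_tac. Qed.

Lemma effb_inc (A : codeType) (e x : A -> nat) :
  effective e -> effective x -> effectiveb (fun a => inc (e a) (x a)).
Proof. by move=> ce cx; rewrite /incident_to; eff_graph_tac. Qed.

Lemma eff_dst (A : codeType) (x : A -> nat) (p : A -> seq nat) :
  effective x -> effective p -> effective (fun a => dst (x a) (p a)).
Proof.
move=> cx cp; apply: (eff_foldl (g := fun _ u e => other e u)) => //.
by apply: eff_other; eff_graph_tac.
Qed.

Lemma eff_dg (A : codeType) (T : A -> seq nat) (x : A -> nat) :
  effective T -> effective x -> effective (fun a => dg (T a) (x a)).
Proof.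
move=> cT cx; have := eff_comp cx (eff_fst (eff_id (pair_code A nat_code))).
by move=> cx'; rewrite /deg_in; eff_graph_tac.
Qed.

Lemma effb_Rm (A : codeType) (T : A -> seq nat) (e : A -> nat) :
  effective T -> effective e -> effectiveb (fun a => Rm (T a) (e a)).
Proof. by move=> cT ce; rewrite /avoiding; eff_graph_tac. Qed.

Lemma effb_dead (A : codeType) (T : A -> seq nat) (x : A -> nat) :
  effective T -> effective x -> effectiveb (fun a => dead (T a) (x a)).
Proof. by move=> cT cx; rewrite /dead; eff_graph_tac; apply: eff_dg. Qed.

(** One fold computes the validity of the walk and its current vertex. *)
Lemma effb_walk (A : codeType) (R : A -> nat -> bool) (x : A -> nat) (p : A ->
  seq nat) :
  effectiveb (fun y : A * nat => R y.1 y.2) -> effective x -> effective p ->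
  effectiveb (fun a => walk (R a) (x a) (p a)).
Proof.
move=> cR cx cp.
pose st a (r : nat * nat) e :=
  (if [&& r.1 == 1, R a e & inc e r.2] then 1 else 0, other e r.2).
have cst : effective (fun y : A * (nat * nat) * nat => st y.1.1 y.1.2 y.2).
  rewrite /st; eff_graph_tac; [|by apply: effb_inc;
    eff_graph_tac|by apply: eff_other; eff_graph_tac].
  pose h (y : A * (nat * nat) * nat) := (y.1.1, y.2).
  by apply: (eff_comp cR (f := h)); rewrite /h; eff_graph_tac.
have cl := eff_foldl (g := st) (eff_pair (eff_const A 1) cx) cst cp.
apply: eff_eq (eff_fst cl) => a.
have gen q (b : bool) u : (foldl (st a) (b : nat, u) q).1 = b && walk (R a) u q.
  elim: q b u => [|e q IHq] b u /=; first by rewrite andbT.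
  rewrite {2}/st /= -[RHS]/(nat_of_bool _) !andbA -IHq.
  by case: b; case: (R a e); case: (inc e u).
exact: (gen _ true).
Qed.

Lemma effb_certified (A : codeType) (T bs : A -> seq nat) (ws : A ->
  seq (seq nat)) :
  effective T -> effective bs -> effective ws -> effectiveb (fun a =>
    certified (T a) (bs a) (ws a)).
Proof.
move=> cT cbs cws; rewrite /certified.
have cT1 : effective (fun x : A * nat => T x.1) :=
  eff_comp cT (eff_fst (eff_id _)).
apply: effb_and; apply: effb_all => //; rewrite /=.
- by apply: effb_not; apply: effb_dead; eff_graph_tac.
- apply: effb_or; first by apply: effb_dead; eff_graph_tac.
  apply: effb_has; last exact: eff_comp cws (eff_fst (eff_id _)).
  apply: effb_and; last first.
    apply: effb_mem; first by apply: eff_dst; eff_graph_tac.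
    exact: eff_comp cbs (eff_fst (eff_fst (eff_id _))).
  apply: (effb_walk (R := fun x e => Rm (T x.1.1) e)); eff_graph_tac.
  apply: effb_Rm; eff_graph_tac.
  exact: eff_comp cT (eff_fst (eff_fst (eff_fst (eff_id _)))).
have cm (h : nat -> nat) : effective h -> effective (fun a => map h (T a)).
  move=> ch; pose st (a : A) (r : seq nat) e := r ++ [:: h e].
  have cst : effective (fun y : A * seq nat * nat => st y.1.1 y.1.2 y.2).
    rewrite /st; apply: eff_cat; eff_graph_tac.
    by apply: eff_cons (eff_const _ [::]); apply: eff_nat1 ch _; eff_graph_tac.
  apply: eff_eq (eff_foldl (g := st) (eff_const A [::]) cst cT) => a.
  have gen s r : foldl (st a) r s = r ++ map h s.
    by elim: s r => [|e s IHs] r /=; rewrite ?cats0 // IHs -catA.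
  exact: gen.
by apply: eff_cat; apply: cm.
Qed.

Lemma all_isV_ends p q : walk isE v0 p -> walk isE v0 q ->
  all isV [:: dst v0 p; dst v0 q].
Proof. by move=> wp wq; rewrite /= !isV_walk_end. Qed.

Section OneWay.
Hypothesis parity : degree_parity src tgt isE (fun w => v0 == w).
Hypothesis one_end : forall T x y,
  infinite_at src tgt (Rm T) x -> infinite_at src tgt (Rm T) y ->
    conn (Rm T) x y.
Hypothesis edge_inf : forall T : seq nat, exists2 e, isE e & e \notin T.

(** The state carries the trail, its last extension and the certificate; the
    step of index [n] makes sure that the edge of index [n] is used. *)
Definition step1 n (y y' : seq nat * (seq nat * seq (seq nat))) :=
  [&& y'.1 == y.1 ++ y'.2.1, y'.2.1 != [::], walk isE v0 y'.1, uniq y'.1,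
      ~~ isE n || (n \in y'.1) & certified y'.1 [:: dst v0 y'.1] y'.2.2].

Lemma extensible1E f : extensible1 src tgt isE v0 f <->
  [/\ walk isE v0 f, uniq f & anchored f [:: dst v0 f]].
Proof.
split=> [[wf uf lf cf]|[wf uf [lf cf]]]; split=> //.
- split=> [b|x /cf]; first by rewrite inE => /eqP->.
  by exists (dst v0 f) => //; rewrite mem_head.
- by apply: lf; rewrite mem_head.
by move=> x /cf[b]; rewrite inE => /eqP->.
Qed.

Lemma run1 : extensible1 src tgt isE v0 [::] -> exists f q : nat -> seq nat,
  [/\ effective f, f 0 = [::], forall n, f n.+1 = f n ++ q n /\ q n != [::],
      forall n, walk isE v0 (f n) /\ uniq (f n) &
      forall n, isE n -> n \in f n.+1].
Proof.
move=> g0; pose Y := pair_code (seq_code nat_code)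
  (pair_code (seq_code nat_code) (seq_code (seq_code nat_code))).
have [||n [f y]|n [f y] [f' [q ws]]|S [cS S0 gS PS]] :=
  @computable_run Y step1 (fun y => extensible1 src tgt isE v0 y.1) ([::],
    ([::], [::])).
- by rewrite /step1; eff_graph_tac; [apply: effb_walk;
    eff_graph_tac|apply: effb_certified; eff_graph_tac;
    apply: eff_cons (eff_const _ [::]); apply: eff_dst; eff_graph_tac].
- exact: g0.
- move=> /= gf; have [e0 ee0 ne0] : exists2 e0, isE e0 & (isE n -> e0 = n).
    have [en|nen] := boolP (isE n); first by exists n.
    by have [e ee _] := edge_inf [::]; exists e.
  have [q [gq e0q q0]] := progress1 edge_conn parity one_end gf ee0.
  have [wq uq aq] := (extensible1E _).1 gq.
  have [||ws Hws] := @certified_complete (f ++ q) [:: dst v0 (f ++ q)] uq _ _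
    aq.
  + exact: walk_all wq.
  + by rewrite /= isV_walk_end.
  exists (f ++ q, (q, ws)); rewrite /step1 /= eqxx q0 wq uq Hws andbT /=.
  by case: (boolP (isE n)) => //= /ne0<-.
- move=> gf /and5P[/= /eqP-> q0 wq uq /andP[_ Hws]]; apply/extensible1E;
    split=> //.
  apply: certified_sound uq (walk_all wq) _ _ Hws;
    last by rewrite /= isV_walk_end.
  by case: (f) (q) q0 => [|? ?] [].
exists (fun n => (S n).1), (fun n => (S n.+1).2.1); split.
- exact: eff_fst cS.
- by rewrite S0.
- by move=> n; have /and5P[/eqP-> q0 _ _ _] := PS n.
- by move=> n; have [] := gS n.
by move=> n en; have /and5P[_ _ _ _ /andP[]] := PS n; rewrite en.
Qed.

End OneWay.

Section TwoWay.
Hypothesis parity : degree_parity src tgt isE (fun=> false).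
Hypothesis two_ends : forall T x y z,
  infinite_at src tgt (Rm T) x -> infinite_at src tgt (Rm T) y ->
    infinite_at src tgt (Rm T) z ->
  [\/ conn (Rm T) x y, conn (Rm T) x z | conn (Rm T) y z].
Hypothesis even_one_end : forall T x y, uniq T -> all isE T ->
  (forall w, ~~ odd (dg T w)) ->
  infinite_at src tgt (Rm T) x -> infinite_at src tgt (Rm T) y ->
    conn (Rm T) x y.
Hypothesis edge_inf : forall T : seq nat, exists2 e, isE e & e \notin T.

Definition step2 n (y y' : (seq nat * seq nat) * ((seq nat * seq nat) * seq (seq
  nat))) :=
  [&& (y'.1.1 == y.1.1 ++ y'.2.1.1) && (y'.1.2 == y.1.2 ++ y'.2.1.2),
      (y'.2.1.1 != [::]) && (y'.2.1.2 != [::]),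
      walk isE v0 y'.1.1 && walk isE v0 y'.1.2, uniq (y'.1.1 ++ y'.1.2),
      ~~ isE n || (n \in y'.1.1 ++ y'.1.2) &
      certified (y'.1.1 ++ y'.1.2) [:: dst v0 y'.1.1; dst v0 y'.1.2] y'.2.2].

Lemma extensible2E f g : extensible2 src tgt isE v0 f g <->
  [/\ walk isE v0 f /\ walk isE v0 g, uniq (f ++ g) &
      anchored (f ++ g) [:: dst v0 f; dst v0 g]].
Proof.
split=> [[wf uf [lf lg] cf]|[wf uf [lf cf]]]; split=> //.
- split=> [b|x /cf[]]; first by rewrite !inE => /orP[]/eqP->.
    by exists (dst v0 f) => //; rewrite mem_head.
  by exists (dst v0 g) => //; rewrite !inE eqxx orbT.
- by split; apply: lf; rewrite !inE eqxx ?orbT.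
by move=> x /cf[b]; rewrite !inE => /orP[]/eqP->; [left|right].
Qed.

Lemma run2 : extensible2 src tgt isE v0 [::] [::] -> exists f q g r : nat ->
  seq nat,
  [/\ effective f /\ effective g, f 0 = [::] /\ g 0 = [::],
      forall n, [/\ f n.+1 = f n ++ q n, q n != [::],
                    g n.+1 = g n ++ r n & r n != [::]],
      forall n, [/\ walk isE v0 (f n), walk isE v0 (g n) & uniq (f n ++ g n)] &
      forall n, isE n -> n \in f n.+1 ++ g n.+1].
Proof.
move=> g0; pose L := seq_code nat_code.
pose Y := pair_code (pair_code L L) (pair_code (pair_code L L) (seq_code L)).
have [||n [[f g] y]|n [[f g] y] [[f' g'] [[q r] ws]]|S [cS S0 gS PS]] :=
  @computable_run Y step2 (fun y => extensible2 src tgt isE v0 y.1.1 y.1.2)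
    (([::], [::]), (([::], [::]), [::])).
- rewrite /step2; eff_graph_tac; [apply: effb_walk;
    eff_graph_tac|apply: effb_walk; eff_graph_tac|].
  apply: effb_certified; eff_graph_tac.
  by do 2 (apply: eff_cons; first by apply: eff_dst; eff_graph_tac);
    apply: eff_const.
- exact: g0.
- move=> /= gf; have [e0 ee0 ne0] : exists2 e0, isE e0 & (isE n -> e0 = n).
    have [en|nen] := boolP (isE n); first by exists n.
    by have [e ee _] := edge_inf [::]; exists e.
  have [q [r [gq e0q q0 r0]]] :=
    progress2 edge_conn edge_inf parity two_ends even_one_end gf ee0.
  have [[wq wr] uq aq] := (extensible2E _ _).1 gq.
  have [||ws Hws] := @certified_complete _ _ uq _ _ aq.
  + by rewrite all_cat (walk_all wq) (walk_all wr).
  + exact: all_isV_ends.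
  exists ((f ++ q, g ++ r), ((q, r), ws)).
  rewrite /step2 /= !eqxx q0 r0 wq wr uq Hws andbT /=.
  by case: (boolP (isE n)) => //= /ne0<-; rewrite e0q.
- move=> gf /and5P[/= /andP[/eqP-> /eqP->] /andP[q0 r0] /andP[wq wr] uq /andP[_
    Hws]].
  apply/extensible2E; split=> //.
  apply: certified_sound uq _ _ (all_isV_ends wq wr) Hws.
    by rewrite all_cat (walk_all wq) (walk_all wr).
  by case: (f) (q) q0 => [|? ?] [].
exists (fun n => (S n).1.1), (fun n => (S n.+1).2.1.1).
exists (fun n => (S n).1.2), (fun n => (S n.+1).2.1.2); split.
- by split; [exact: eff_fst (eff_fst cS)|exact: eff_snd (eff_fst cS)].
- by rewrite S0.
- by move=> n; have /and5P[/andP[/eqP-> /eqP->] /andP[-> ->] _ _ _] := PS n.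
- by move=> n; have [[? ?] ? _ _] := gS n.
by move=> n en; have /and5P[_ _ _ _ /andP[]] := PS n; rewrite en.
Qed.

End TwoWay.
End Algorithm.

(** * The infinite path approximated by growing trails *)

Section Limit.
Variables (isE : pred nat) (src tgt : nat -> nat) (v0 : nat).
Variables (f q : nat -> seq nat).
Hypothesis src_effective : effective src.
Hypothesis tgt_effective : effective tgt.
Hypothesis f_effective : effective f.
Hypothesis fS : forall n, f n.+1 = f n ++ q n /\ q n != [::].
Hypothesis f_trail : forall n, is_walk src tgt isE v0 (f n) /\ uniq (f n).

(** The trail [f n.+1] has more than [n] edges and its first edges are final, so
    that its item of index [n] exists and never changes. *)
Definition limit_edge n := nth 0 (f n.+1) n.

Definition limit_vertex n :=
  nat_rect (fun=> nat) v0 (fun i u => opposite src tgt (limit_edge i) u) n.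

Lemma eff_limit_edge : effective limit_edge.
Proof. exact: eff_nth (eff_comp f_effective (eff_S (eff_id _))) (eff_id _). Qed.

Lemma eff_limit_vertex : effective limit_vertex.
Proof.
apply: (eff_rec (g := fun _ i u => opposite src tgt (limit_edge i) u)
  (eff_const _ v0) _ (eff_id _)).
apply: eff_other => //; last exact: eff_snd (eff_id _).
exact: eff_comp eff_limit_edge (eff_snd (eff_fst (eff_id _))).
Qed.

Lemma limit_size n : n <= size (f n).
Proof.
elim: n => // n IHn; have [-> qn] := fS n; rewrite size_cat.
by case: (q n) qn => //= e s _; rewrite addnS ltnS (leq_trans IHn) ?leq_addr.
Qed.

Lemma limit_prefix m n : m <= n -> exists s, f n = f m ++ s.
Proof.
elim: n => [|n IHn]; first by rewrite leqn0 => /eqP->; exists [::];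
  rewrite cats0.
rewrite leq_eqVlt ltnS => /orP[/eqP->|/IHn[s fn]].
  by exists [::]; rewrite cats0.
by exists (s ++ q n); rewrite (fS n).1 fn catA.
Qed.

Lemma limit_nth m i : i < size (f m) -> nth 0 (f m) i = limit_edge i.
Proof.
move=> im; rewrite /limit_edge; case: (leqP m i.+1) =>
  [|/ltnW] /limit_prefix[s ->].
  by rewrite nth_cat im.
by rewrite nth_cat limit_size.
Qed.

Lemma limit_take m i : i <= size (f m) -> limit_vertex i = walk_end src tgt v0
  (take i (f m)).
Proof.
elim: i => [|i IHi] im; first by rewrite take0.
rewrite (take_nth 0) // -cats1 walk_end_cat /= -IHi 1?ltnW //.
by rewrite limit_nth.
Qed.

Lemma limit_step i : isE (limit_edge i) /\ incident_to src tgt (limit_edge i)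
  (limit_vertex i).
Proof.
have [wf _] := f_trail i.+1; rewrite (@limit_take i.+1 i) ?(leq_trans _
  (limit_size _)) //.
move: wf; rewrite -{1}(cat_take_drop i (f i.+1)) walk_cat.
by rewrite (drop_nth 0) ?limit_size //= => /andP[_ /and3P[]].
Qed.

Lemma limit_in i : limit_edge i \in f i.+1.
Proof. by apply: mem_nth; apply: limit_size. Qed.

Lemma limit_in_le i n : i < n -> limit_edge i \in f n.
Proof. by move=> /limit_prefix[s ->]; rewrite mem_cat limit_in. Qed.

Lemma limit_mem e n : e \in f n -> exists i, limit_edge i = e.
Proof.
move=> en; exists (index e (f n)).
by rewrite -(@limit_nth n) ?nth_index // index_mem.
Qed.

Lemma limit_inj : injective limit_edge.
Proof.
move=> i j; pose n := (maxn i j).+1.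
have [_ un] := f_trail n; have ni : i < size (f n).
  by apply: leq_trans (limit_size n); rewrite ltnS leq_maxl.
have nj : j < size (f n) by apply: leq_trans (limit_size n);
  rewrite ltnS leq_maxr.
by rewrite -(limit_nth ni) -(limit_nth nj) => /eqP; rewrite nth_uniq // => /eqP.
Qed.

End Limit.

(** * Graphs seen through their codes *)

Lemma ecard_seq (T : eqType) (s : seq T) (A : set T) :
  uniq s -> (forall x, A x <-> x \in s) -> ecard A = Some (size s).
Proof.
move=> us As; have -> : A = [set` s] by apply/seteqP; split=> x /As.
rewrite /ecard; case: pselect => [fin|[]]; last exact: finite_seq.
congr Some; case: cid => m /= sm; apply/card_eq_II.
apply: card_eq_trans (_ : card_eq `I_m [set` s]) _;
  first by rewrite card_eq_sym.
have inj : {in [set` s] &, injective (index^~ s)}.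
  move=> x y; rewrite !inE /= => xs ys e.
  by rewrite -(nth_index x xs) -(nth_index x ys) e.
have := inj_card_eq inj; rewrite card_eq_sym.
suff -> : (index^~ s) @` [set` s] = `I_(size s) by [].
apply/seteqP; split=> [_ [x /= xs <-]|i /= lis]; first by rewrite /= index_mem.
have x0 : T by case: (s) lis.
by exists (nth x0 s i); rewrite /= ?mem_nth // index_uniq.
Qed.

Lemma ecard_None (T : eqType) (A : set T) : ecard A = None ->
  forall s : seq T, exists x, A x /\ x \notin s.
Proof.
rewrite /ecard; case: pselect => // nfin _ s; apply: contrapT => H; apply: nfin.
apply: sub_finite_set (finite_seq s) => x Ax /=.
by apply/negPn/negP => nxs; apply: H; exists x.
Qed.

Lemma ecard_Some (T : Type) (A : set T) n : ecard A = Some n ->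
  finite_set A /\ exists f : T -> nat,
    (forall x, A x -> f x < n) /\ set_inj A f.
Proof.
rewrite /ecard; case: pselect => // fin; case: cid => m /= Am [<-]; split=> //.
by have [f [fA finj _]] := elimT card_set_bijP Am; exists f; split.
Qed.

Section Coding.
Variables (V E : pointedType) (G : graph V E) (vi : V -> nat) (ei : E -> nat).
Hypothesis vi_inj : set_inj (verts G) vi.
Hypothesis ei_inj : set_inj (edges G) ei.

Definition isE n := `[< exists2 e, edges G e & ei e = n >].
Definition isV n := `[< exists2 v, verts G v & vi v = n >].
Definition isJ n x y :=
  `[< exists e u v, [/\ joins G e u v, ei e = n, vi u = x & vi v = y] >].

Definition vdec n : V :=
  if pselect (exists2 v, verts G v & vi v = n) is left h then projT1 (cid2 h)
  else point.

Definition edec n : E :=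
  if pselect (exists2 e, edges G e & ei e = n) is left h then projT1 (cid2 h)
  else point.

Lemma vdecK v : verts G v -> vdec (vi v) = v.
Proof.
move=> Gv; rewrite /vdec; case: pselect => [h|[]]; last by exists v.
by case: cid2 => w /= Gw vw; apply: vi_inj; rewrite ?inE.
Qed.

Lemma edecK e : edges G e -> edec (ei e) = e.
Proof.
move=> Ge; rewrite /edec; case: pselect => [h|[]]; last by exists e.
by case: cid2 => w /= Gw ew; apply: ei_inj; rewrite ?inE.
Qed.

Lemma isEP n : isE n -> edges G (edec n) /\ ei (edec n) = n.
Proof. by move=> /asboolP[e Ge <-]; rewrite edecK. Qed.

Lemma isVP n : isV n -> verts G (vdec n) /\ vi (vdec n) = n.
Proof. by move=> /asboolP[v Gv <-]; rewrite vdecK. Qed.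

Lemma isE_ei e : edges G e -> isE (ei e).
Proof. by move=> Ge; apply/asboolP; exists e. Qed.

Lemma isV_vi v : verts G v -> isV (vi v).
Proof. by move=> Gv; apply/asboolP; exists v. Qed.

Lemma endpoint_code_ex n : exists m, ~~ isE n || isJ n (cfst m) (csnd m).
Proof.
have [/asboolP[e Ge <-]|] := boolP (isE n); last by exists 0.
have [u [v j]] := joins_ex Ge; exists (cpair (vi u) (vi v)).
by apply/asboolP; exists e, u, v; rewrite cpairK1 cpairK2.
Qed.

(** The least code of a pair of endpoints gives a computable orientation. *)
Definition endpoint_code n := ex_minn (endpoint_code_ex n).
Definition src n := cfst (endpoint_code n).
Definition tgt n := csnd (endpoint_code n).

Lemma isJ_ends n : isE n -> isJ n (src n) (tgt n).
Proof.
by move=> en; rewrite /src /tgt /endpoint_code; case: ex_minnP => m; rewrite en.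
Qed.

Lemma joins_code e u v : joins G e u v ->
  [/\ isE (ei e), incident_to src tgt (ei e) (vi u) & opposite src tgt (ei e)
    (vi u) = vi v].
Proof.
move=> j; have [Ge Gu Gv] := joins_in j.
have /asboolP[e' [u' [v' [j']]]] := isJ_ends (isE_ei Ge).
have [Ge' Gu' Gv'] := joins_in j'.
move=> /ei_inj; rewrite !inE => /(_ Ge' Ge) ee; rewrite {}ee {Ge' e'} in j' *.
rewrite /incident_to /opposite => <- <-; split; first by exists e.
  by have [[-> ->]|[-> ->]] := joins_uniq j j'; rewrite eqxx ?orbT.
have [[-> ->]|[-> ->]] := joins_uniq j j'; first by rewrite eqxx.
by case: eqP.
Qed.

Lemma code_joins e u v : edges G e -> verts G u -> verts G v ->
  incident_to src tgt (ei e) (vi u) -> opposite src tgt (ei e) (vi u) = vi v ->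
  joins G e u v.
Proof.
move=> Ge Gu Gv; have [x [y j]] := joins_ex Ge; have [_ Gx Gy] := joins_in j.
have [_ ix ox] := joins_code j; have [_ iy oy] := joins_code (joins_sym j).
case/(incident_cases ix); rewrite ?ox.
  move=> /vi_inj; rewrite !inE => /(_ Gu Gx)->; rewrite ox.
  by move=> /vi_inj; rewrite !inE => /(_ Gy Gv)<-.
move=> /vi_inj; rewrite !inE => /(_ Gu Gy)->; rewrite oy.
by move=> /vi_inj; rewrite !inE => /(_ Gx Gv)<-; apply: joins_sym.
Qed.

Lemma isV_inc n x : isE n -> incident_to src tgt n x -> isV x.
Proof.
move=> /isEP[Ge <-]; have [u [v j]] := joins_ex Ge; have [_ Gu Gv] :=
  joins_in j.
have [_ iu ou] := joins_code j.
by move/(incident_cases iu) => [->|->]; rewrite ?ou; apply: isV_vi.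
Qed.

Lemma joins_edec n x : isE n -> incident_to src tgt n x ->
  joins G (edec n) (vdec x) (vdec (opposite src tgt n x)).
Proof.
move=> en nx; have [Ge een] := isEP en.
have [Gx vx] := isVP (isV_inc en nx).
have [Gy vy] := isVP (isV_inc en (incident_opposite src tgt n x)).
by apply: code_joins; rewrite ?een ?vx ?vy.
Qed.

(** ** Paths and walks *)

Lemma path_linked (H : graph V E) (R : pred nat) u v :
  (forall e x y, joins H e x y -> joins G e x y /\ R (ei e)) ->
  joined_by_path H u v -> linked src tgt R (vi u) (vi v).
Proof.
move=> HR [a [b [p [ab _ <- <-]]]].
have [n bE] : exists n : nat, b = (a + Posz n)%R by exists (absz (b - a)%R);
  lia.
suff: forall k, k <= n ->
    linked src tgt R (vi (hom_v p a)) (vi (hom_v p (a + Posz k)%R)).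
  by move/(_ n (leqnn n)); rewrite -bE.
elim=> [_|k IHk kn]; first by rewrite GRing.addr0; apply: linked_refl.
apply: linked_trans (IHk (ltnW kn)) _.
have j : joins (int_segment a b) (a + Posz k)%R (a + Posz k)%R (a + Posz
  k.+1)%R.
  have -> : (a + Posz k.+1 = a + Posz k + 1)%R by lia.
  by split; [split=> /=; lia|left].
have [jG Re] := HR _ _ _ (hom_joins p j); have [_ iu ou] := joins_code jG.
by rewrite -ou; apply: linked_edge Re iu (incident_opposite _ _ _ _).
Qed.

(** Erasing repeated edges turns a walk into a trail, whose vertices and edges
    are then decoded. *)
Lemma linked_path (H : graph V E) (R : pred nat) u v :
  (forall e x y, joins G e x y -> R (ei e) -> joins H e x y) ->
  (forall n, R n -> isE n) -> verts G u -> verts H u -> verts G v ->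
  linked src tgt R (vi u) (vi v) -> joined_by_path H u v.
Proof.
move=> HR RE Gu Hu Gv /linked_trail[p [wp up dp]].
pose fv (c : int) := vdec (walk_end src tgt (vi u) (take (absz c) p)).
pose fe (c : int) := edec (nth 0 p (absz c)).
have step (i : nat) : i < size p -> joins H (fe i) (fv i) (fv i.+1).
  move=> ip; rewrite /fv /fe /= (take_nth 0) // -cats1 walk_end_cat /=.
  have : is_walk src tgt R (walk_end src tgt (vi u) (take i p)) (drop i p).
    by move: wp; rewrite -{1}(cat_take_drop i p) walk_cat => /andP[].
  rewrite (drop_nth 0) // => /and3P[Rn nx _].
  by apply: HR; [apply: joins_edec (RE _ Rn) nx|rewrite (isEP (RE _ Rn)).2].
have vfv (i : nat) : verts H (fv i).
  case: i => [|i]; first by rewrite /fv /= take0 /= vdecK.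
  case: (ltnP i (size p)) => [ip|pi].
    by have [] := joins_in (step _ ip).
  rewrite /fv /= take_oversize ?(leqW pi) //.
  case: (posnP (size p)) => [/size0nil->|p0]; first by rewrite /= vdecK.
  have lp : (size p).-1 < size p by rewrite prednK.
  by have [_ _] := joins_in (step _ lp); rewrite /fv /= prednK // take_size.
have segE (c : int) : (0 <= c <= Posz (size p))%R ->
    exists2 i : nat, c = i & i <= size p.
  by case: c => // i /andP[_ ip]; exists i.
have hv c : verts (int_segment 0 (size p)) c -> verts H (fv c).
  by move=> /segE[i -> _].
have iS (i : nat) : (Posz i + 1)%R = Posz i.+1 by lia.
have hj c x y : joins (int_segment 0 (size p)) c x y ->
  joins H (fe c) (fv x) (fv y).
  move=> [[/segE[i -> _] /= ip]].
  have ip1 : i < size p by rewrite iS lez_nat in ip.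
  by rewrite iS; case=> -[-> ->]; [|apply: joins_sym]; apply: step.
exists 0%R, (Posz (size p)), (GraphHom hv hj); split=> //=.
- move=> c c'; rewrite !inE => -[/segE[i -> _] /= ip] [/segE[i' -> _] /= ip'].
  have ip1 : i < size p by rewrite iS lez_nat in ip.
  have ip1' : i' < size p by rewrite iS lez_nat in ip'.
  rewrite /fe /= => ee.
  have RN k : k < size p -> isE (nth 0 p k).
    by move=> kp; apply: RE; apply: (walk_in wp); apply: mem_nth.
  move/(congr1 ei): ee; rewrite (isEP (RN _ ip1)).2 (isEP (RN _ ip1')).2.
  by move/eqP; rewrite nth_uniq // => /eqP->.
- by rewrite /fv take0 /= vdecK.
by rewrite /fv /= take_size dp vdecK.
Qed.

(** ** Degrees *)

Section Degree.
Variables (H : graph V E) (P : pred nat) (v : V).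
Hypothesis HP : forall e x y, joins H e x y <-> joins G e x y /\ P (ei e).
Hypothesis Gv : verts G v.

Lemma incident_code e : incident H v e <->
  [/\ edges G e, incident_to src tgt (ei e) (vi v) & P (ei e)].
Proof.
split=> [[u /HP[j Pe]]|[Ge iv Pe]].
  by have [Ge _ _] := joins_in j; have [_ iv _] := joins_code j.
exists (vdec (opposite src tgt (ei e) (vi v))); apply/HP; split=> //.
by have := joins_edec (isE_ei Ge) iv; rewrite edecK // vdecK.
Qed.

Lemma loops_code e : loops H v e <->
  incident H v e /\ (src (ei e) == vi v) && (tgt (ei e) == vi v).
Proof.
rewrite /loops /mkset; split=> [j|[iv /andP[sv tv]]].
  split; first by exists v.
  have [jG _] := (HP _ _ _).1 j; have [_ _] := joins_code jG.
  by rewrite /opposite; case: eqVneq => [_ ->|/eqP nv /nv]; rewrite ?eqxx.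
have [Ge _ Pe] := (incident_code e).1 iv; apply/HP; split=> //.
by apply: code_joins; rewrite // /incident_to /opposite sv //; apply/eqP.
Qed.

(** Loops count twice on both sides: once as incident edges and once as loops in
    [deg], and as two equal endpoints in [deg_in]. *)
Lemma deg_code :
  if deg H v is Some n then exists L,
    [/\ uniq L, forall e, e \in L <-> [/\ isE e,
      incident_to src tgt e (vi v) & P e]
      & deg_in src tgt L (vi v) = n]
  else forall T : seq nat, exists e,
    [/\ isE e, P e, e \notin T & incident_to src tgt e (vi v)].
Proof.
rewrite /deg; case ki: (ecard (incident H v)) => [k|] /=; last first.
  move=> T; have [e [/incident_code[Ge ie Pe] neT]] :=
    ecard_None ki (map edec T).
  exists (ei e); split=> //; first exact: isE_ei.
  by apply: contra neT => eT; apply/mapP; exists (ei e); rewrite ?edecK.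
have [/finite_seqP[s si] _] := ecard_Some ki.
pose s' := undup s; have us' : uniq s' := undup_uniq s.
have is' e : incident H v e <-> e \in s' by rewrite mem_undup si.
have Gs' e : e \in s' -> edges G e by move=> /is'/incident_code[].
pose lp e := (src (ei e) == vi v) && (tgt (ei e) == vi v).
have -> : ecard (loops H v) = Some (count lp s').
  rewrite -size_filter; apply: ecard_seq; first exact: filter_uniq.
  move=> e; rewrite mem_filter; split=> [/loops_code[/is' es' lpe]|].
    by rewrite /lp lpe.
  by case/andP=> lpe /is' ie; apply/loops_code.
move: ki; rewrite (ecard_seq us' is') => -[<-]; exists (map ei s'); split.
- rewrite map_inj_in_uniq // => e f /Gs' Ge /Gs' Gf;
    exact: ei_inj (mem_set Ge) (mem_set Gf).
- move=> n; split=> [/mapP[e /is'/incident_code[Ge ie Pe] ->]|].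
    by split=> //; apply: isE_ei.
  move=> [/isEP[Ge en] iv Pn]; apply/mapP; exists (edec n) => //.
  by apply/is'/incident_code; rewrite en.
have : all (fun e => incident_to src tgt (ei e) (vi v)) s'.
  by apply/allP => e /is'/incident_code[].
rewrite /deg_in big_map; elim: s' {us' is' Gs'} => [|e t IHt] /=.
  by rewrite big_nil.
case/andP=> ie /IHt; rewrite big_cons => ->; rewrite /lp.
move: ie; rewrite /incident_to; case: (src _ == _); case: (tgt _ == _) =>
  //= _; lia.
Qed.

End Degree.

(** The second condition is about the numbers that are not codes of vertices:
    no edge is incident to them, so that their degree is even. *)
Lemma degree_parity_code (par : nat -> bool) :
  (forall v n, verts G v -> deg G v = Some n -> odd n = par (vi v)) ->
  (forall x, ~~ isV x -> par x = false) ->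
  degree_parity src tgt isE par.
Proof.
move=> Hpar HV x; have [/isVP[Gv vx]|nVx] := boolP (isV x); last first.
  right; exists [::]; split=> //; last by rewrite /deg_in big_nil HV.
  by move=> e; split=> // -[ee /(isV_inc ee)]; rewrite (negbTE nVx).
have HP e y z : joins G e y z <-> joins G e y z /\
  predT (ei e) by split=> // -[].
have := deg_code HP Gv; have := Hpar _ _ Gv; rewrite vx.
case: (deg G (vdec x)) => [n /(_ n erefl) oddn [L [uL HL dL]]|_ HT].
  right; exists L; split=> //; last by rewrite dL.
  by move=> e; rewrite HL; split=> [[]|[]].
by left=> T; have [e [ee _ neT ie]] := HT T; exists e.
Qed.

Lemma deg_in_lt (T L : seq nat) x e : uniq T -> uniq L -> e \notin T ->
  (forall n, n \in T -> incident_to src tgt n x -> n \in L) -> e \in L ->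
  incident_to src tgt e x -> deg_in src tgt T x < deg_in src tgt L x.
Proof.
move=> uT uL neT TL eL ex; pose p := [seq n <- e :: T | incident_to src tgt n
  x].
have up : uniq p by rewrite filter_uniq //= neT.
have pL : {subset p <= L}.
  by move=> n; rewrite mem_filter in_cons => /andP[nx /orP[/eqP->|/TL]] //;
    apply.
rewrite (deg_in_perm _ _ _ (perm_diff up uL pL)) deg_in_cat.
have -> : deg_in src tgt p x = deg_in src tgt (e :: T) x.
  apply: deg_in_full => //=; first by rewrite neT.
    by move=> n; rewrite mem_filter => /andP[].
  by move=> n nT nx; rewrite mem_filter nx.
rewrite {2}/deg_in big_cons; move: ex; rewrite /incident_to -/(deg_in _ _ T x).
by case: (src e == x); case: (tgt e == x) => // _; lia.
Qed.

Lemma dead_degree (d : nat -> nat) (T : seq nat) x :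
  (forall v, verts G v -> d (vi v) = enat_code (deg G v)) ->
  uniq T -> all isE T -> isV x ->
  reflect (~ nonisolated src tgt (avoiding isE T) x) (dead src tgt d T x).
Proof.
move=> Hd uT /allP eT /isVP[Gv vx].
have HP e y z : joins G e y z <-> joins G e y z /\
  predT (ei e) by split=> // -[].
have := deg_code HP Gv; have := Hd _ Gv; rewrite vx /dead => -> H.
apply: (iffP idP).
  case: (deg G (vdec x)) H => //= n [L [uL HL <-]]; rewrite eqSS => /eqP dT.
  case=> e /andP[ee neT] ie.
  have TL f : f \in T -> incident_to src tgt f x ->
    f \in L by move=> /eT ef fe; apply/HL.
  have := deg_in_lt uT uL neT TL ((HL e).2 (And3 ee ie erefl)) ie.
  by rewrite dT ltnn.
move=> nl; case: (deg G (vdec x)) H => /= [n [L [uL HL <-]]|/(_ T)[e [ee _ neT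
  ie]]].
  apply/eqP; congr _.+1; apply/esym; apply: deg_in_full => // e.
    case/HL=> ee ie _; apply/negPn/negP => neT; apply: nl.
    by exists e => //; rewrite /avoiding ee.
  by move=> /eT ee ie; apply/HL.
by case: nl; exists e => //; rewrite /avoiding ee.
Qed.

(** ** Components *)

Section Removal.
Variable T : seq nat.

Local Notation RT := (avoiding isE T).
Local Notation conn := (linked src tgt).
Local Notation infc := (infinite_at src tgt).

Definition coded_edges : set E := [set e | edges G e /\ ei e \in T].

Local Notation H := (remove_edges G coded_edges).

Lemma coded_edges_finite : finite_set coded_edges /\ coded_edges `<=` edges G.
Proof.
split=> [|e []//]; apply: (sub_finite_set _ (finite_seq (map edec T))).
by move=> e [Ge eT]; apply/mapP; exists (ei e); rewrite ?edecK.
Qed.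

Lemma removed_joins e u v : joins H e u v <-> joins G e u v /\ RT (ei e).
Proof.
split=> [[[Ge neT] j]|[j /andP[ee neT]]].
  by split=> //; rewrite /avoiding isE_ei //=; apply/negP => eT; apply: neT.
split=> //; split; first by have [] := joins_in j.
by case=> _ eT; rewrite eT in neT.
Qed.

Lemma removed_edges e : edges H e <-> edges G e /\ RT (ei e).
Proof.
split=> [He|[Ge Re]].
  have [u [v /removed_joins[j Re]]] := joins_ex He.
  by have [] := joins_in j.
have [u [v j]] := joins_ex Ge.
have jH : joins H e u v by apply/removed_joins.
by have [] := joins_in jH.
Qed.

Definition component_edges x : set E :=
  [set e | edges H e /\ conn RT x (src (ei e))].

Definition component_graph x : graph V E := edge_induced H (component_edges x).

Definition component_codes x : pred nat := fun n => RT n &&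
  `[< conn RT x (src n) >].

Lemma component_walk x y p : conn RT x y -> is_walk src tgt RT y p ->
  is_walk src tgt (component_codes x) y p.
Proof.
elim: p y => //= e p IHp y xy /and3P[Re ey wp].
rewrite ey /component_codes Re asboolT /=; last exact: linked_trans xy
  (linked_src Re ey).
apply: IHp => //.
exact: linked_trans xy (linked_edge Re ey (incident_opposite _ _ _ _)).
Qed.

Lemma component_joins x e u v : joins (component_graph x) e u v <->
  joins H e u v /\ conn RT x (vi u).
Proof.
split=> [[[/removed_edges[Ge Re] xe] j]|[j xu]].
  split=> //; have /removed_joins[jG _] := j.
  have [_ iu _] := joins_code jG.
  by apply: linked_trans xe (linked_sym (linked_src Re iu)).
have /removed_joins[jG Re] := j; have [_ iu _] := joins_code jG.
split=> //; split; first by have [] := joins_in j.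
exact: linked_trans xu (linked_src Re iu).
Qed.

Lemma component_edgesE x e : edges (component_graph x) e <-> edges H e /\
  conn RT x (src (ei e)).
Proof. by split=> [[_ []]|[]]. Qed.

Lemma component_verts x v : verts (component_graph x) v -> verts G v /\
  conn RT x (vi v).
Proof.
move=> [e [u [xe j]]]; have /component_joins[/removed_joins[jG _] xv] : joins
  (component_graph x) e v u by [].
by have [_ ? _] := joins_in jG.
Qed.

(** A connected subgraph [D] that contains the component has all its vertices
    linked to a vertex of the component, hence to [x]. *)
Lemma component_graphP x : infc RT x -> component H (component_graph x).
Proof.
move=> ix; split.
- split; first by move=> v [e [u [_ j]]]; have [_ ? _] := joins_in j.
    by move=> e /component_edgesE[].
  move=> e u v /component_edgesE[He xe]; split=> [/component_joins[]//|j].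
  by split.
- move=> u v Cu Cv; have [Gu xu] := component_verts Cu; have [Gv xv] :=
    component_verts Cv.
  apply: (linked_path (R := component_codes x)) => //.
  + move=> e y z j /andP[Re /asboolP xe]; split; last exact/removed_joins.
    by split=> //; apply/removed_edges; split=> //; have [] := joins_in j.
  + by move=> n /andP[/andP[]].
  have [p wp dp] := linked_trans (linked_sym xu) xv.
  by exists p => //; apply: component_walk.
move=> D [DV DE DJ] Dconn [CV CE CJ].
have [e0 [Re0 _ xe0]] := ix [::].
have [Ge0 ee0] := isEP (andP Re0).1.
have [u0 [v0 j0]] := joins_ex Ge0.
have Cj0 : joins (component_graph x) (edec e0) u0 v0.
  split; last by apply/removed_joins; rewrite ee0.
  by split; [apply/removed_edges|]; rewrite ee0.
have [_ Cu0 _] := joins_in Cj0; have [_ xu0] := component_verts Cu0.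
have DR e y z : joins D e y z -> joins G e y z /\ RT (ei e).
  by move=> j; have [De _ _] := joins_in j; apply/removed_joins/(DJ _ _ _ De).
have Dx w : verts D w -> conn RT x (vi w).
  by move=> Dw; apply: linked_trans xu0 (path_linked DR (Dconn _ _ (CV _ Cu0)
    Dw)).
have DC e y z : joins D e y z -> joins (component_graph x) e y z.
  move=> j; have [De Dy _] := joins_in j.
  by apply/component_joins; split; [apply/(DJ _ _ _ De)|apply: Dx].
split.
- move=> w Dw; have /DV[e [u [Se j]]] := Dw.
  have jH : joins H e w u by [].
  have jC : joins (component_graph x) e w u by apply/component_joins;
    split=> //; apply: Dx.
  by have [] := joins_in jC.
- by move=> e De; have [y [z /DC j]] := joins_ex De; have [] := joins_in j.
move=> e y z De; split=> [/DC//|/component_joins[j _]].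
by apply/(DJ _ _ _ De).
Qed.

Lemma component_graph_infinite x : infc RT x ->
  infinite_graph (component_graph x).
Proof.
move=> ix /finite_seqP[s es]; have [e [Re nes xe]] := ix (map ei s).
have [Ge ee] := isEP (andP Re).1.
have : edges (component_graph x) (edec e).
  by apply/component_edgesE; split; [apply/removed_edges|]; rewrite ee.
rewrite es /= => ei_s; case/negP: nes; apply/mapP.
by exists (edec e); rewrite ?ee.
Qed.

Lemma component_graph_eq x y : infc RT x -> component_graph x = component_graph
  y -> conn RT x y.
Proof.
move=> ix exy; have [e [Re _ xe]] := ix [::].
have [Ge ee] := isEP (andP Re).1.
have : edges (component_graph x) (edec e).
  by apply/component_edgesE; split; [apply/removed_edges|]; rewrite ee.
rewrite exy => /component_edgesE[_]; rewrite ee => ye.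
exact: linked_trans xe (linked_sym ye).
Qed.

(** Infinite components with the same number are equal, hence share an edge,
    which links their vertices. *)
Lemma infinite_components k : enat_le (nb_infinite_components H) (Some k) ->
  exists c : nat -> nat, forall x y, infc RT x -> c x < k /\
    (infc RT y -> c x = c y -> conn RT x y).
Proof.
rewrite /nb_infinite_components.
case nE: ecard => [n|//] /= nk; have [_ [c [cn cinj]]] := ecard_Some nE.
have inC x : infc RT x -> component H (component_graph x) /\
  infinite_graph (component_graph x).
  by move=> ix; split; [apply: component_graphP|apply:
    component_graph_infinite].
exists (fun x => c (component_graph x)) => x y ix; split.
  by apply: leq_trans nk; apply: cn; apply: inC.
move=> iy cxy; apply: component_graph_eq => //.
by apply: cinj cxy; rewrite inE; apply: inC.
Qed.

Lemma one_component x y : enat_le (nb_infinite_components H) (Some 1) ->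
  infc RT x -> infc RT y -> conn RT x y.
Proof.
move=> /infinite_components[c Hc] ix iy.
have [cx] := Hc x y ix; have [cy _] := Hc y x iy; apply=> //; lia.
Qed.

Lemma two_components x y z : enat_le (nb_infinite_components H) (Some 2) ->
  infc RT x -> infc RT y -> infc RT z ->
  [\/ conn RT x y, conn RT x z | conn RT y z].
Proof.
move=> /infinite_components[c Hc] ix iy iz.
have [cx xy] := Hc x y ix; have [_ xz] := Hc x z ix.
have [cy yz] := Hc y z iy; have [cz _] := Hc z x iz.
have [/xy|nxy] := eqVneq (c x) (c y); first by constructor 1; auto.
have [/xz|nxz] := eqVneq (c x) (c z); first by constructor 2; auto.
by constructor 3; apply: yz => //; lia.
Qed.

Lemma coded_even : uniq T -> all isE T ->
  (forall w, ~~ odd (deg_in src tgt T w)) -> forall v,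
  verts (edge_induced G coded_edges) v ->
  even_degree (edge_induced G coded_edges) v.
Proof.
move=> uT /allP eT Teven v [e [u [_ j]]]; have [_ Gv _] := joins_in j.
have HP f y z : joins (edge_induced G coded_edges) f y z <->
    joins G f y z /\ mem T (ei f).
  split=> [[[]]//|[jf fT]]; split=> //; split=> //.
  by have [] := joins_in jf.
have := deg_code HP Gv; rewrite /even_degree.
case: (deg _ v) => [n [L [uL HL dL]]|/(_ T)[f [_ /= fT]]]; last by rewrite fT.
exists n => //; rewrite -dL (_ : deg_in _ _ L _ = deg_in src tgt T (vi v)) //.
apply: deg_in_full => //; first by move=> f /HL[].
by move=> f fT fv; apply/HL; split=> //; apply: eT.
Qed.

End Removal.

(** * Eulerian paths *)

Hypothesis G_computable : computable_graph G vi ei.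
Variable d : nat -> nat.
Hypothesis d_computable : computable_nat d.
Hypothesis dE : forall v, verts G v -> d (vi v) = enat_code (deg G v).
Hypothesis G_inf : infinite_set (edges G).
Hypothesis G_conn : connected_graph G.

Lemma isE_effective : effectiveb isE.
Proof.
have [_ [_ [c Hc] _ _]] := G_computable; exists c => x.
suff -> : isE (thead x) =
  `[< [set x : 1.-tuple nat | exists2 e, edges G e & x = [tuple ei e]] x >].
  exact: Hc.
apply: asbool_equiv_eq => /=; split=> [[e Ge ex]|[e Ge ->]].
  exists e => //; rewrite ex; case: x {ex} => -[|n []] // sx.
  exact: val_inj.
by exists e.
Qed.

Lemma isJ_computable : computable3 (fun n x y => isJ n x y : nat).
Proof.
have [_ [_ _ _ [c Hc]]] := G_computable; exists c => x.
set b := isJ _ _ _.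
suff -> : b = `[< [set x : 3.-tuple nat | exists e u v,
    joins G e u v /\ x = [tuple ei e; vi u; vi v]] x >] by exact: Hc.
apply: asbool_equiv_eq => /=; rewrite !(tnth_nth 0).
split=> [[e [u [v [j en ux vy]]]]|[e [u [v [j ->]]]]]; last by exists e, u, v.
exists e, u, v; split=> //; rewrite en ux vy.
case: x {en ux vy b} => -[|n [|y [|z []]]] // sx; exact: val_inj.
Qed.

Lemma endpoint_code_computable : computable_nat (endpoint_code).
Proof.
pose b (p : nat * nat) := ~~ isE p.1 || isJ p.1 (cfst p.2) (csnd p.2).
have cb : effectiveb b.
  apply: effb_or; first by apply: effb_not; apply: (eff_nat1 (F :=
    isE)) isE_effective _; eff_tac.
  apply: (eff_nat3 isJ_computable); first exact: (eff_fst (eff_id _)).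
    exact: (eff_nat1 computable_cfst (eff_snd (eff_id _))).
  exact: (eff_nat1 computable_csnd (eff_snd (eff_id _))).
have cnb : computable2 (fun n m => ~~ b (n, m) : nat).
  have cb' : computable_nat (fun p => ~~ b (cfst p, csnd p) : nat).
    exact: (effb_not cb).
  apply: computable_ext (computable_app cb' computable2_pair) => x /=.
  by rewrite cpairK1 cpairK2.
apply: (computable_nat_mu cnb) => [n|n m]; rewrite /endpoint_code;
  case: ex_minnP => k bk Hmin; first by rewrite /b /= bk.
by rewrite ltnNge; apply: contraNT; rewrite lt0b negbK => /Hmin.
Qed.

Lemma src_effective : effective src.
Proof. exact: computable_nat_comp computable_cfst endpoint_code_computable. Qed.

Lemma tgt_effective : effective tgt.
Proof. exact: computable_nat_comp computable_csnd endpoint_code_computable. Qed.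

Lemma G_edge_conn x y : nonisolated src tgt isE x ->
  nonisolated src tgt isE y ->
  linked src tgt isE x y.
Proof.
move=> [e ee ex] [f ef fy].
have [Gx <-] := isVP (isV_inc ee ex).
have [Gy <-] := isVP (isV_inc ef fy).
apply: (path_linked) (G_conn Gx Gy) => g u v j; split=> //.
by have [Gg _ _] := joins_in j; apply: isE_ei.
Qed.

Lemma G_edge_inf (T : seq nat) : exists2 n, isE n & n \notin T.
Proof.
apply: contrapT => /forall2NP HT; apply: G_inf.
apply: sub_finite_set (finite_seq (map edec T)) => e Ge /=.
apply/mapP; exists (ei e); last by rewrite edecK.
have [/(_ (isE_ei Ge))//|/negP] := HT (ei e).
by rewrite negbK.
Qed.

Section LimitPath.
Variables (v0 : V) (f q : nat -> seq nat).
Hypothesis fS : forall n, f n.+1 = f n ++ q n /\ q n != [::].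
Hypothesis f_trail : forall n, is_walk src tgt isE (vi v0) (f n) /\ uniq (f n).

Local Notation le := (limit_edge f).
Local Notation lv := (limit_vertex src tgt (vi v0) f).

Lemma limit_joins n : joins G (edec (le n)) (vdec (lv n)) (vdec (lv n.+1)).
Proof.
have [en nx] := limit_step fS f_trail n; exact: joins_edec en nx.
Qed.

Lemma limit_isE n : isE (le n). Proof. by have [] := limit_step fS f_trail n.
  Qed.

Lemma limit_vertexK n : vi (vdec (lv n)) = lv n.
Proof.
have [en nx] := limit_step fS f_trail n.
by have [] := isVP (isV_inc en nx).
Qed.

Lemma limit_edgeK n : ei (edec (le n)) = le n.
Proof. by have [] := isEP (limit_isE n). Qed.

End LimitPath.

Lemma eulerian_one_way (v0 : V) : verts G v0 ->
  nonisolated src tgt isE (vi v0) ->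
  degree_parity src tgt isE (fun w => vi v0 == w) ->
  number_of_ends G (Some 1) ->
  exists p : graph_hom nat_line G, eulerian p /\ computable_path1 vi ei p.
Proof.
move=> Gv0 lv0 parity [Gends _].
have one_end T x y : infinite_at src tgt (avoiding isE T) x ->
  infinite_at src tgt (avoiding isE T) y ->
    linked src tgt (avoiding isE T) x y.
  have [fT sT] := coded_edges_finite T.
  exact: one_component (Gends _ fT sT).
have Rm0 : avoiding isE [::] = isE by apply/funext => e;
  rewrite /avoiding andbT.
have good0 : extensible1 src tgt isE (vi v0) [::].
  split=> //; rewrite Rm0 //= => x; exact: G_edge_conn.
have [f [q [cf f0 fS ftr fcov]]] := run1 isE_effective src_effective
  tgt_effective d_computable
  G_edge_conn (isV_vi Gv0) (isV_inc)
  (fun T x => @dead_degree d T x dE)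
  parity one_end G_edge_inf good0.
pose fv n := vdec (limit_vertex src tgt (vi v0) f n).
pose fe n := edec (limit_edge f n).
have jn n : joins G (fe n) (fv n) (fv n.+1) := limit_joins fS ftr n.
have hv n : verts nat_line n -> verts G (fv n).
  by move=> _; have [] := joins_in (jn n).
have hj n x y : joins nat_line n x y -> joins G (fe n) (fv x) (fv y).
  by move=> [_ [[-> ->]|[-> ->]]]; [|apply: joins_sym]; apply: jn.
have fe_inj i j : fe i = fe j -> i = j.
  move/(congr1 ei); rewrite /fe (limit_edgeK fS ftr) (limit_edgeK fS ftr).
  exact: limit_inj fS ftr _ _.
exists (GraphHom hv hj); split.
  split=> [i j _ _ /fe_inj//|e Ge].
  have [i ie] := limit_mem fS (fcov _ (isE_ei Ge)).
  exists i; split=> [|j [_ je]]; first by rewrite /= /fe ie edecK.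
  by apply: fe_inj; rewrite /= in je; rewrite je /fe ie edecK.
split.
  apply: computable_nat_ext (eff_limit_vertex (vi v0) src_effective
    tgt_effective cf) => n /=.
  exact/esym/(limit_vertexK fS ftr).
apply: computable_nat_ext (eff_limit_edge cf) => n /=;
  exact/esym/(limit_edgeK fS ftr).
Qed.

(** The trails [f] and [g] from [v0] are glued: edge [n] of [f] joins [n] to
    [n + 1], and edge [n] of [g] joins [- n] to [- n - 1]. *)
Lemma eulerian_two_way (v0 : V) : verts G v0 ->
  nonisolated src tgt isE (vi v0) ->
  (forall v, verts G v -> infinite_degree G v \/ even_degree G v) ->
  number_of_ends G (Some 1) \/ number_of_ends G (Some 2) ->
  (forall S : set E, finite_set S -> S `<=` edges G ->
     (forall v, verts (edge_induced G S) v ->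
        even_degree (edge_induced G S) v) ->
     nb_infinite_components (remove_edges G S) = Some 1) ->
  exists p : graph_hom int_line G, eulerian p /\ computable_path2 vi ei p.
Proof.
move=> Gv0 lv0 Geven Gends Gone.
have parity : degree_parity src tgt isE (fun=> false).
  apply: degree_parity_code => // v n Gv dn.
  case: (Geven v Gv) => [|[m]]; first by rewrite /infinite_degree dn.
  by rewrite dn => -[->] /negbTE.
have two_ends T x y z : infinite_at src tgt (avoiding isE T) x ->
    infinite_at src tgt (avoiding isE T) y ->
      infinite_at src tgt (avoiding isE T) z ->
    [\/ linked src tgt (avoiding isE T) x y, linked src tgt (avoiding isE T) x z
      | linked src tgt (avoiding isE T) y z].
  have [fT sT] := coded_edges_finite T.
  apply: two_components; case: Gends => -[Gends _]; last exact: Gends.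
  by have := Gends _ fT sT; case: nb_infinite_components => //= n /leqW.
have even_one_end T x y : uniq T -> all isE T ->
    (forall w, ~~ odd (deg_in src tgt T w)) ->
      infinite_at src tgt (avoiding isE T) x ->
    infinite_at src tgt (avoiding isE T) y ->
      linked src tgt (avoiding isE T) x y.
  move=> uT eT oT; have [fT sT] := coded_edges_finite T.
  by apply: one_component; rewrite (Gone _ fT sT (coded_even uT eT oT)).
have Rm0 : avoiding isE [::] = isE by apply/funext => e;
  rewrite /avoiding andbT.
have good0 : extensible2 src tgt isE (vi v0) [::] [::].
  split=> //; rewrite Rm0 //= => x lx; left; exact: G_edge_conn.
have [f [q [g [r [[cf cg] [f0 g0] fgS fgtr fgcov]]]]] :=
  run2 isE_effective src_effective tgt_effective d_computable
  G_edge_conn (isV_vi Gv0) isV_inc (fun T x => @dead_degree d T x dE)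
  parity two_ends even_one_end G_edge_inf good0.
have fS n : f n.+1 = f n ++ q n /\ q n != [::] by have [] := fgS n.
have gS n : g n.+1 = g n ++ r n /\ r n != [::] by have [] := fgS n.
have ftr n : is_walk src tgt isE (vi v0) (f n) /\ uniq (f n).
  by have [wf _] := fgtr n; rewrite cat_uniq => /andP[].
have gtr n : is_walk src tgt isE (vi v0) (g n) /\ uniq (g n).
  by have [_ wg] := fgtr n; rewrite cat_uniq => /and3P[].
pose lf := limit_edge f; pose lg := limit_edge g.
pose vf := limit_vertex src tgt (vi v0) f; pose vg :=
  limit_vertex src tgt (vi v0) g.
pose fv (c : int) := match c with Posz n => vdec (vf n) | Negz n =>
  vdec (vg n.+1) end.
pose fe (c : int) := match c with Posz n => edec (lf n) | Negz n =>
  edec (lg n) end.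
have jc (c : int) : joins G (fe c) (fv c) (fv (c + 1)%R).
  case: c => n.
    have -> : (Posz n + 1)%R = Posz n.+1 by lia.
    exact: limit_joins fS ftr n.
  apply: joins_sym; case: n => [|n].
    by rewrite (_ : (Negz 0 + 1)%R = Posz 0) //; apply: (limit_joins gS gtr 0).
  rewrite (_ : (Negz n.+1 + 1)%R = Negz n); last by lia.
  exact: (limit_joins gS gtr n.+1).
have hv c : verts int_line c -> verts G (fv c).
  by move=> _; have [] := joins_in (jc c).
have hj c x y : joins int_line c x y -> joins G (fe c) (fv x) (fv y).
  by move=> [_ [[-> ->]|[-> ->]]]; [|apply: joins_sym]; apply: jc.
have ne i j : lf i <> lg j.
  pose n := (maxn i j).+1; have [_ _] := fgtr n.
  rewrite cat_uniq => /and3P[_ /hasPn dis _] e.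
  have := dis (lg j) (limit_in_le gS (_ : j < n)); rewrite -e.
  by rewrite (limit_in_le fS) ?ltnS ?leq_maxl ?leq_maxr // => /(_ isT).
have ef n : ei (edec (lf n)) = lf n := limit_edgeK fS ftr n.
have eg n : ei (edec (lg n)) = lg n := limit_edgeK gS gtr n.
have vfK n : vi (vdec (vf n)) = vf n := limit_vertexK fS ftr n.
have vgK n : vi (vdec (vg n)) = vg n := limit_vertexK gS gtr n.
have fe_inj : injective fe.
  move=> [i|i] [j|j] /(congr1 ei); rewrite /fe ?ef ?eg.
  - by move/(limit_inj fS ftr)->.
  - by move/ne.
  - by move/esym/ne.
  - by move/(limit_inj gS gtr)->.
exists (GraphHom hv hj); split.
  split=> [i j _ _ /fe_inj//|e Ge].
  have [c ce] : exists c, fe c = e.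
    have := fgcov _ (isE_ei Ge); rewrite mem_cat.
    case/orP=> [/(limit_mem fS)|/(limit_mem gS)] [i ie].
      by exists (Posz i); rewrite /fe /lf ie edecK.
    by exists (Negz i); rewrite /fe /lg ie edecK.
  by exists c; split=> // c' [_ c'e]; apply: fe_inj; rewrite ce -c'e.
have cvf : computable_nat vf := eff_limit_vertex (vi v0) src_effective
  tgt_effective cf.
have cvg : computable_nat vg := eff_limit_vertex (vi v0) src_effective
  tgt_effective cg.
have clf : computable_nat lf := eff_limit_edge cf.
have clg : computable_nat lg := eff_limit_edge cg.
split; split=> /=.
- by apply: computable_nat_ext cvf => n /=; rewrite vfK.
- by apply: computable_nat_ext cvg => -[|n]; [exact: esym (vfK 0)|exact: esym
    (vgK n.+1)].
- by apply: computable_nat_ext clf => n /=; rewrite ef.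
have c0 : effectiveb (fun n : nat => n == 0).
  exact: effb_eqn (eff_id _) (eff_const _ _).
have ce : computable_nat (fun n => if n == 0 then lf 0 else lg n.-1).
  exact: eff_if c0 (eff_const _ _) (eff_nat1 clg (eff_nat1 computable_pred
    (eff_id _))).
apply: computable_nat_ext ce => -[|n]; first exact: esym (ef 0).
exact: esym (eg n).
Qed.

End Coding.

Theorem theorem1 (V E : pointedType) (G : graph V E)
    (vi : V -> nat) (ei : E -> nat) :
  moderately_computable_graph G vi ei ->
  (satisfies_E1 G ->
     exists p : graph_hom nat_line G, eulerian p /\ computable_path1 vi ei p) /\
  (satisfies_E2 G ->
     exists p : graph_hom int_line G, eulerian p /\ computable_path2 vi ei p).
Proof.
move=> [Gc [d dc dE]]; have [[vI eI] _] := Gc.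
have live_joins e u v : joins G e u v -> nonisolated (src G vi ei) (tgt G vi ei)
  (isE G ei) (vi u).
  by move=> j; have [ee iu _] := joins_code vi eI j; exists (ei e).
split=> [[[_ Ginf] Gconn deg1 Gends]|[[_ Ginf] Gconn deg2 Gends one]];
  last first.
  have [e Ge] : edges G !=set0 by apply: infinite_setN0.
  have [u [v j]] := joins_ex Ge; have [_ Gu _] := joins_in j.
  exact: (eulerian_two_way vI eI Gc dc dE Ginf Gconn Gu (live_joins _ _ _ j)).
(* the path starts at the odd vertex, or else at any vertex of infinite degree *)
have [v0 [Gv0 nd0 par0]] : exists v0, [/\ verts G v0, deg G v0 <> Some 0 &
    forall v n, verts G v -> deg G v = Some n -> odd n = (vi v0 == vi v)].
  case: deg1 => [[v0 [[Gv0 odd0] uniq0]]|[[v0 Gv0 inf0] nodd]].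
    exists v0; split=> //; first by case: odd0 => n ->; case: n.
    move=> v n Gv dv; apply/idP/eqP => [on|/vI].
      by rewrite (uniq0 v) //; split=> //; exists n.
    rewrite !inE => /(_ Gv0 Gv) ev; case: odd0 => m; rewrite ev dv => -[<-] //.
  exists v0; split=> //; first by rewrite inf0.
  move=> v n Gv dv; case: eqP => [/vI|_].
    by rewrite !inE => /(_ Gv0 Gv) ev; move: inf0;
      rewrite /infinite_degree ev dv.
  by apply/negbTE/negP => on; apply: (nodd v Gv); exists n.
have HP e y z : joins G e y z <-> joins G e y z /\
  predT (ei e) by split=> // -[].
apply: (eulerian_one_way vI eI Gc dc dE Ginf Gconn Gv0) Gends.
  have := deg_code vI eI HP Gv0; case: (deg G v0) nd0 => [n n0|_ /(_ [::])].
    move=> [[|e L] [_ HL dL]]; first by case: n0; rewrite -dL /deg_in big_nil.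
    by have [ee ie _] := (HL e).1 (mem_head _ _); exists e.
  by move=> [e [ee _ _ ie]]; exists e.
apply: degree_parity_code => // x nx; apply/negbTE; apply: contra nx => /eqP <-.
exact: isV_vi.
Qed.
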